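(* Let $\omega\in(0,\pi/2]$ and let $\Theta$ be an angle set with rotation angle $\omega$. Any maximum polygon cap $K_\Theta\in\mathcal{K}^{\mathrm c}_\Theta$ is balanced, i.e. $\sigma_{K_\Theta}(\{t\})=\tau_{K_\Theta}(t)$ for every $t\in\Theta^\diamond$.
   Context: $|X|$ is area. $u_t=(\cos t,\sin t)$, $v_t=(-\sin t,\cos t)$. For a convex body $K$ (nonempty compact convex subset of $\mathbb{R}^2$), $h_K(t)=\sup_{p\in K}p\cdot u_t$, $e_K(t)=\{p\in K:p\cdot u_t=h_K(t)\}$, $v_K^{+}(t)$ (resp. $v_K^-(t)$) is the endpoint of $e_K(t)$ farthest in direction $v_t$ (resp. $-v_t$), and $\sigma_K(\{t\})$ is the length of $e_K(t)$ ($\sigma_K$ is the surface area measure). A cap with rotation angle $\omega$ is a convex body $K$ with $h_K(\omega)=h_K(\pi/2)=1$, $h_K(\omega+\pi)=h_K(3\pi/2)=0$, which is an intersection of closed half-planes $\{p:p\cdot u_t\le c\}$ with $t\in[0,\omega]\cup[\pi/2,\omega+\pi/2]\cup\{\omega+\pi,3\pi/2\}$. An angle set $\Theta$ with rotation angle $\omega$ is a nonempty finite subset of $(0,\omega)$ and $\Theta^\diamond=\Theta\cup(\Theta+\pi/2)\cup\{\omega,\pi/2\}$. $\mathcal{K}^{\mathrm c}_\Theta$ is the set of caps with rotation angle $\omega$ that are intersections of closed half-planes $\{p\cdot u_t\le c\}$ with $t\in\Theta^\diamond\cup\{\omega+\pi,3\pi/2\}$. Let $F_\omega=\{p:p\cdot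 u_\omega\ge0,\ p\cdot u_{\pi/2}\ge0\}$, $Q_K^-(t)=\{p:p\cdot u_t<h_K(t)-1,\ p\cdot v_t<h_K(t+\pi/2)-1\}$, $o_\omega=(\tan(\pi/4-\omega/2),1)$. For $K\in\mathcal{K}^{\mathrm c}_\Theta$: $\mathcal{N}_\Theta(K)=F_\omega\cap\bigcup_{t\in\Theta}Q_K^-(t)$ and $\mathcal{A}_\Theta(K)=|K|-|\mathcal{N}_\Theta(K)|$. A maximum polygon cap with angle set $\Theta$ is a $K\in\mathcal{K}^{\mathrm c}_\Theta$ with $o_\omega\in K$ maximizing $\mathcal{A}_\Theta$ over $\mathcal{K}^{\mathrm c}_\Theta$. For $K\in\mathcal{K}^{\mathrm c}_\Theta$ the boundary of the closed set $F_\omega\setminus\mathcal{N}_\Theta(K)$ is the disjoint union of the open half-line from $v_K^+(\omega+\pi/2)$ in direction $v_\omega$ (endpoint excluded), the open half-line from $v_K^-(0)$ in direction $u_0$ (endpoint excluded), and a polyline $\mathbf{p}_K$ connecting $v_K^+(\omega+\pi/2)$ to $v_K^-(0)$ with strictly increasing $x$-coordinates, each of whose segments has normal angle in $\Theta^\diamond$. For $t\in\Theta^\diamond$, $\tau_K(t)$ is the sum of the lengths of all edges of $\mathbf{p}_K$ with normal angle $t$ (i.e. perpendicular to $u_t$). *)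

(* Defs.v *)
From mathcomp Require Import all_boot all_order all_algebra.
From mathcomp Require Import all_classical all_reals all_analysis.

Set Implicit Arguments.
Unset Strict Implicit.
Unset Printing Implicit Defensive.

Import Order.TTheory GRing.Theory Num.Theory.
Import numFieldNormedType.Exports.

Local Open Scope classical_set_scope.
Local Open Scope ring_scope.

Section Plane.
Context {R : realType}.
Local Notation plane := (R * R)%type.
Implicit Types (p q : plane) (A K : set plane) (t c : R).

Definition dot p q : R := p.1 * q.1 + p.2 * q.2.

(* The library norm on R * R is the sup norm, hence the explicit formula. *)
Definition euclid_dist p q : R := Num.sqrt (dot (p - q) (p - q)).

Definition uvec t : plane := (cos t, sin t).
Definition vvec t : plane := (- sin t, cos t).

Definition area A : \bar R := (@lebesgue_measure R \x @lebesgue_measure R)%E A.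

Definition boundary A : set plane := closure A `\` interior A.

Definition halfplane t c : set plane := [set p | dot p (uvec t) <= c].

Definition segment p q : set plane :=
  [set (1 - s) *: p + s *: q | s in `[0, 1]].

Definition open_ray p (d : plane) : set plane :=
  [set p + s *: d | s in `]0, +oo[].

Definition convex_body K : Prop := [/\ K !=set0, compact K & convex_set K].

Definition supp K t : R := sup [set dot p (uvec t) | p in K].

Definition face K t : set plane := [set p | K p /\ dot p (uvec t) = supp K t].

(* For a convex body K the face is a nonempty compact segment parallel to
   vvec t, so exactly one point satisfies each of the two descriptions below. *)
Definition vplus K t : plane :=
  get [set p | face K t p /\
    forall q, face K t q -> dot q (vvec t) <= dot p (vvec t)].

Definition vminus K t : plane :=
  get [set p | face K t p /\
    forall q, face K t q -> dot p (vvec t) <= dot q (vvec t)].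

(* The length of the segment face K t, i.e. the mass of {t} under the surface
   area measure of K. *)
Definition sigma K t : R := euclid_dist (vplus K t) (vminus K t).

(* K is an intersection of an arbitrary family of closed half-planes with
   normal angles in T; a pair a = (t, c) encodes the half-plane p . u_t <= c. *)
Definition halfplane_intersection (T : set R) K : Prop :=
  exists2 S : set (R * R),
    (forall a, S a -> T a.1) & K = \bigcap_(a in S) halfplane a.1 a.2.

End Plane.

Section Caps.
Context {R : realType}.
Local Notation plane := (R * R)%type.
Variables (omega : R) (Theta : set R).
Implicit Types (K : set plane) (s : seq plane).

Definition is_cap K : Prop :=
  [/\ convex_body K,
      supp K omega = 1 /\ supp K (pi / 2) = 1,
      supp K (omega + pi) = 0 /\ supp K (3 * pi / 2) = 0 &
      halfplane_intersection
        (`[0, omega] `|` `[pi / 2, omega + pi / 2]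
          `|` [set omega + pi; 3 * pi / 2]) K].

Definition angle_set : Prop :=
  [/\ finite_set Theta, Theta !=set0 & Theta `<=` `]0, omega[].

Definition diamond : set R :=
  Theta `|` [set t + pi / 2 | t in Theta] `|` [set omega; pi / 2].

Definition polygon_cap K : Prop :=
  is_cap K /\
  halfplane_intersection (diamond `|` [set omega + pi; 3 * pi / 2]) K.

Definition fan : set plane :=
  [set p | 0 <= dot p (uvec omega) /\ 0 <= dot p (uvec (pi / 2))].

Definition Qminus K (t : R) : set plane :=
  [set p | dot p (uvec t) < supp K t - 1 /\
           dot p (vvec t) < supp K (t + pi / 2) - 1].

Definition o_point : plane := (tan (pi / 4 - omega / 2), 1).

Definition niche K : set plane := fan `&` \bigcup_(t in Theta) Qminus K t.

Definition sofa_area K : \bar R := (area K - area (niche K))%E.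

Definition maximum_polygon_cap K : Prop :=
  [/\ polygon_cap K, K o_point &
      forall K', polygon_cap K' -> (sofa_area K' <= sofa_area K)%E].

Definition edges s : seq (plane * plane) := zip s (behead s).

Definition has_normal (t : R) (e : plane * plane) : bool :=
  dot (e.2 - e.1) (uvec t) == 0.

Definition polyline_set s : set plane :=
  [set` s] `|` \bigcup_(e in [set` edges s]) segment e.1 e.2.

(* s lists the vertices, from left to right, of the polyline that together
   with two open half-lines makes up the boundary of fan minus niche. *)
Definition is_niche_polyline K s : Prop :=
  let a := vplus K (omega + pi / 2) in
  let b := vminus K 0 in
  let L := open_ray a (vvec omega) in
  let M := open_ray b (uvec 0) in
  [/\ ohead s = Some a /\ last a s = b,
      sorted (fun p q : plane => p.1 < q.1) s,
      forall e, e \in edges s -> exists2 t, diamond t & has_normal t e,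
      boundary (fan `\` niche K) = L `|` M `|` polyline_set s &
      [/\ L `&` M = set0, L `&` polyline_set s = set0
        & M `&` polyline_set s = set0]].

(* Lists satisfying is_niche_polyline differ only by vertices interior to an
   edge, so the lengths computed from niche_polyline do not depend on the
   choice. *)
Definition niche_polyline K : seq plane := xget [::] (is_niche_polyline K).

Definition tau K (t : R) : R :=
  \sum_(e <- edges (niche_polyline K) | has_normal t e) euclid_dist e.1 e.2.

Definition balanced K : Prop := forall t, diamond t -> sigma K t = tau K t.

End Caps.

(* Main.v *)
Require Import Defs.
From mathcomp Require Import all_boot all_order all_algebra.
From mathcomp Require Import all_classical all_reals all_analysis.
From mathcomp Require Import measurable_realfun ring lra.
Import Order.TTheory GRing.Theory Num.Theory.
Import numFieldNormedType.Exports.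
Set Implicit Arguments.
Unset Strict Implicit.
Unset Printing Implicit Defensive.
Local Open Scope classical_set_scope.
Local Open Scope ring_scope.

(** Why a maximum polygon cap is balanced.

Move the side of K with normal u_t, t in the diamond, inward by a small e, and let
the two lower sides recede until the widths in the directions omega and pi / 2 are
again 1. Up to a translation the result is a polygon cap [cut_profile], so by
maximality its sofa area does not exceed that of K [maximum_cap_le]. To first order
the cap loses e times sigma(t). Every side of the niche lies on a supporting line of
K shifted inward by 1, so lowering the support value at t by e removes from the niche
at least e times tau(t); support values at other angles can only decrease too, which
shrinks the niche further. Receding lower sides add to the fan, and there the cap
gains at least what the niche gains. Letting e tend to 0 gives tau(t) <= sigma(t)
for every t in the diamond, including omega and pi / 2 [core_le_full_edge].

The upper boundary of K and the polyline of the niche join the same two points.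
Projecting both to the horizontal axis, the sums of sin t * sigma(t) and of
sin t * tau(t) over the diamond both equal the horizontal distance of these points;
what matters is that the first sum is at most this distance and the second at least
[sum_full_edge, polyline_total_width]. Since sin t > 0, the termwise inequality is an
equality.

All angles of the diamond lie in the open interval from 0 to pi, so a side with one
of these normals is the graph of an affine function. Accordingly K is the region
between the graphs of a convex function [ground] and a concave one [roof], and the
niche is the region between [ground] and a lattice polynomial [crest] in the affine
functions [wall]. Areas become integrals over the abscissa, sin t * sigma(t) is the
measure of the abscissas at which the roof follows the line with normal u_t
[sin_sigma], and sin t * tau(t) is bounded by the measure of those at which the crest
follows the corresponding wall [polyline_width]. Distinct normals have distinct slopes,
so the coincidences of two walls form a finite set, and the first variation can be
done one abscissa at a time [thickness_exchange]. The polyline itself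
is the graph of the crest, with vertices at the coincidences [niche_polyline_exists]. *)

(** * Lines of given normal angle *)

Section Lines.
Context {R : realType}.
Implicit Types (p q : R * R) (d s x y : R).

Definition line d s x : R := (d - x * cos s) / sin s.

Lemma dot_uvec p s : dot p (uvec s) = p.1 * cos s + p.2 * sin s.
Proof. by []. Qed.

Lemma dot_uvecD p q s : dot (p + q) (uvec s) = dot p (uvec s) + dot q (uvec s).
Proof. by rewrite /dot /=; ring. Qed.

Lemma dot_uvecB p q s : dot (p - q) (uvec s) = dot p (uvec s) - dot q (uvec s).
Proof. by rewrite /dot /=; ring. Qed.

Lemma dot_uvecZ a p s : dot (a *: p) (uvec s) = a * dot p (uvec s).
Proof. by rewrite /dot /= /GRing.scale /=; ring. Qed.

Lemma uvec_pihalf s : uvec (s + pi / 2) = vvec s :> R * R.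
Proof. by rewrite /uvec /vvec cosDpihalf sinDpihalf. Qed.

Lemma dot_up p : dot p (uvec (pi / 2)) = p.2.
Proof. by rewrite dot_uvec cos_pihalf sin_pihalf mulr0 mulr1 add0r. Qed.

Lemma dot_right p : dot p (uvec 0) = p.1.
Proof. by rewrite dot_uvec cos0 sin0 mulr0 mulr1 addr0. Qed.

Lemma dot_le_line d s p : 0 < sin s ->
  (dot p (uvec s) <= d) = (p.2 <= line d s p.1).
Proof.
by move=> s0; rewrite /line ler_pdivlMr// dot_uvec addrC -lerBrDr.
Qed.

Lemma line_le_dot d s p : 0 < sin s ->
  (d <= dot p (uvec s)) = (line d s p.1 <= p.2).
Proof.
by move=> s0; rewrite /line ler_pdivrMr// dot_uvec addrC lerBlDr.
Qed.

Lemma dot_lt_line d s p : 0 < sin s ->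
  (dot p (uvec s) < d) = (p.2 < line d s p.1).
Proof. by move=> s0; rewrite !ltNge line_le_dot. Qed.

Lemma line_lt_dot d s p : 0 < sin s ->
  (d < dot p (uvec s)) = (line d s p.1 < p.2).
Proof. by move=> s0; rewrite !ltNge dot_le_line. Qed.

Lemma dot_eq_line d s p : 0 < sin s ->
  (dot p (uvec s) = d) <-> (p.2 = line d s p.1).
Proof.
move=> s0; split=> H; apply/eqP; rewrite eq_le.
  by rewrite -dot_le_line// -line_le_dot// H lexx.
by rewrite dot_le_line// line_le_dot// H lexx.
Qed.

Lemma ler_line s x d d' : 0 < sin s -> (line d s x <= line d' s x) = (d <= d').
Proof. by move=> s0; rewrite /line ler_pM2r ?invr_gt0// lerD2r. Qed.

Lemma line_shift d e s x : line (d - e) s x = line d s x - e / sin s.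
Proof. by rewrite /line -mulrBl; congr (_ / _); ring. Qed.

Lemma line_translate d s x (v : R * R) : 0 < sin s ->
  line (d + dot v (uvec s)) s (x + v.1) = line d s x + v.2.
Proof. by move=> s0; rewrite /line dot_uvec; field; rewrite gt_eqF. Qed.

(** Distinct normal angles between 0 and pi have distinct slopes, so two such
    lines coincide above a single abscissa; explicitly solving for it makes the
    set of all coincidences finite. *)
Lemma line_cross d d' s s' x : 0 < s < pi -> 0 < s' < pi -> s != s' ->
  line d s x = line d' s' x ->
  x = (d' * sin s - d * sin s') / sin (s - s').
Proof.
move=> s0 s'0 ss' E.
have S0 : 0 < sin s by exact: sin_gt0_pi.
have S'0 : 0 < sin s' by exact: sin_gt0_pi.
have D0 : sin (s - s') != 0.
  case/andP: s0 => s0 s1; case/andP: s'0 => s'0 s'1.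
  have [lt|gt|eq] := ltgtP s s'; last by rewrite eq eqxx in ss'.
    rewrite -opprB sinN oppr_eq0 gt_eqF// sin_gt0_pi//; lra.
  by rewrite gt_eqF// sin_gt0_pi//; lra.
apply: (mulIf D0); rewrite divfK//.
move: E; rewrite /line => /(congr1 (fun z => z * (sin s * sin s'))).
have -> : (d - x * cos s) / sin s * (sin s * sin s') = (d - x * cos s) * sin s'.
  by field; rewrite gt_eqF.
have -> : (d' - x * cos s') / sin s' * (sin s * sin s') = (d' - x * cos s') * sin s.
  by field; rewrite gt_eqF.
move=> E; rewrite sinB; lra.
Qed.

End Lines.

(** * Caps and niches as regions between piecewise linear graphs *)

Section BigMinMax.
Context {R : realType} {I : eqType}.
Implicit Types (z y : R) (l : seq I).

Lemma le_bigmin_seqE z y l (F : I -> R) :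
  (y <= \big[Order.min/z]_(i <- l) F i) = (y <= z) && all (fun i => y <= F i) l.
Proof.
elim: l => [|i l IH]; first by rewrite big_nil andbT.
by rewrite big_cons le_min IH /= andbCA.
Qed.

Lemma bigmax_seq_leE z y l (F : I -> R) :
  (\big[Order.max/z]_(i <- l) F i <= y) = (z <= y) && all (fun i => F i <= y) l.
Proof.
elim: l => [|i l IH]; first by rewrite big_nil andbT.
by rewrite big_cons ge_max IH /= andbCA.
Qed.

Lemma le_bigmax_seqE z y l (F : I -> R) :
  (y <= \big[Order.max/z]_(i <- l) F i) = (y <= z) || has (fun i => y <= F i) l.
Proof.
elim: l => [|i l IH]; first by rewrite big_nil orbF.
by rewrite big_cons le_max IH /= orbCA.
Qed.

Lemma continuous_bigmin l (f0 : R -> R) (F : I -> R -> R) :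
  continuous f0 -> (forall i, i \in l -> continuous (F i)) ->
  continuous (fun x => \big[Order.min/f0 x]_(i <- l) F i x).
Proof.
move=> c0; elim: l => [|i l IH] cF.
  by rewrite (_ : (fun x => _) = f0)//; apply/funext => x; rewrite big_nil.
rewrite (_ : (fun x => _) = (fun x => Order.min (F i x)
    (\big[Order.min/f0 x]_(i <- l) F i x))); last first.
  by apply/funext => x; rewrite big_cons.
move=> x; apply: (@continuous_min R R); first by apply: cF; rewrite inE eqxx.
by apply: IH => j jl; apply: cF; rewrite inE jl orbT.
Qed.

Lemma continuous_bigmax l (f0 : R -> R) (F : I -> R -> R) :
  continuous f0 -> (forall i, i \in l -> continuous (F i)) ->
  continuous (fun x => \big[Order.max/f0 x]_(i <- l) F i x).
Proof.
move=> c0; elim: l => [|i l IH] cF.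
  by rewrite (_ : (fun x => _) = f0)//; apply/funext => x; rewrite big_nil.
rewrite (_ : (fun x => _) = (fun x => Order.max (F i x)
    (\big[Order.max/f0 x]_(i <- l) F i x))); last first.
  by apply/funext => x; rewrite big_cons.
move=> x; apply: (@continuous_max R R); first by apply: cF; rewrite inE eqxx.
by apply: IH => j jl; apply: cF; rewrite inE jl orbT.
Qed.

End BigMinMax.

Section Profile.
Context {R : realType} (omega : R) (th : seq R).
Implicit Types (c : R -> R) (s t x y : R) (p : R * R).

(** The diamond as a list. It may contain repetitions, for instance omega twice
    when omega = pi / 2. *)
Definition normals : seq R := th ++ [seq t + pi / 2 | t <- th] ++ [:: omega; pi / 2].

Definition roof c x : R :=
  \big[Order.min/line (c (pi / 2)) (pi / 2) x]_(s <- normals) line (c s) s x.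

(** A side of the niche lies on the supporting line of the cap with the same
    normal, moved inward by 1. For the angles omega and pi / 2 this is also a
    lower side of the cap, because the widths of a cap in these two directions
    are 1. *)
Definition wall c s x : R := line (c s - 1) s x.

Definition ground c x : R := Order.max (wall c omega x) (wall c (pi / 2) x).

Lemma groundE c x : ground c x = Order.max (wall c omega x) (wall c (pi / 2) x).
Proof. by []. Qed.

(** The upper boundary of the niche: a quadrant lies below both of its walls,
    and the niche is the part of the fan below some quadrant boundary. *)
Definition crest c x : R :=
  \big[Order.max/ground c x]_(t <- th) Order.min (wall c t x) (wall c (t + pi / 2) x).

(** For the support values c of a cap this is the cap itself, and [hole c] is
    its niche. For other values of c the lower sides are at distance 1 from the
    upper ones, so that [body c] is a translate of a cap when all its sides
    touch it. *)
Definition body c : set (R * R) :=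
  [set p | [/\ forall s, s \in normals -> dot p (uvec s) <= c s,
    c omega - 1 <= dot p (uvec omega) & c (pi / 2) - 1 <= dot p (uvec (pi / 2))]].

Definition hole c : set (R * R) :=
  [set p | [/\ c omega - 1 <= dot p (uvec omega),
    c (pi / 2) - 1 <= dot p (uvec (pi / 2)) &
    exists2 t, t \in th & dot p (uvec t) < c t - 1 /\
      dot p (uvec (t + pi / 2)) < c (t + pi / 2) - 1]].

Lemma mem_normals s : (s \in normals) =
  [|| s \in th, s - pi / 2 \in th, s == omega | s == pi / 2].
Proof.
rewrite /normals !mem_cat !inE; congr [|| _, _, _ | _].
apply/mapP/idP => [[t tth ->]|H]; first by rewrite addrK.
by exists (s - pi / 2); rewrite ?subrK.
Qed.

Lemma omega_normal : omega \in normals.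
Proof. by rewrite mem_normals eqxx !orbT. Qed.

Lemma pihalf_normal : pi / 2 \in normals.
Proof. by rewrite mem_normals eqxx !orbT. Qed.

Lemma theta_normal t : t \in th -> t \in normals.
Proof. by rewrite mem_normals => ->. Qed.

Lemma theta_pihalf_normal t : t \in th -> t + pi / 2 \in normals.
Proof. by rewrite mem_normals addrK => ->; rewrite orbT. Qed.

Lemma le_roof c x y :
  (y <= roof c x) <-> (forall s, s \in normals -> y <= line (c s) s x).
Proof.
rewrite /roof le_bigmin_seqE; split=> [/andP[_ /allP]//|H].
by rewrite H ?pihalf_normal//=; apply/allP.
Qed.

Lemma ground_le c x y : (ground c x <= y) = (wall c omega x <= y) && (wall c (pi / 2) x <= y).
Proof. by rewrite /ground ge_max. Qed.

(** The crest is a lattice polynomial in the walls, and this is all that is used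
    about it, together with [le_crest]. *)
Lemma crest_le c x y : (crest c x <= y) <->
  (ground c x <= y /\
   forall t, t \in th -> wall c t x <= y \/ wall c (t + pi / 2) x <= y).
Proof.
rewrite /crest bigmax_seq_leE; split=> [/andP[-> /allP H]|[-> H]].
  by split=> // t /H; rewrite ge_min => /orP.
by apply/allP => t /H; rewrite ge_min => /orP.
Qed.

Lemma lt_crest c x y : ground c x <= y -> (y < crest c x) <->
  (exists2 t, t \in th & y < wall c t x /\ y < wall c (t + pi / 2) x).
Proof.
move=> fy; rewrite ltNge; split=> [/negP H|[t tth [H1 H2]]].
  apply: contrapT => H'; apply: H; apply/crest_le; split=> // t tth.
  case: (leP (wall c t x) y) => [|h1]; first by left.
  case: (leP (wall c (t + pi / 2) x) y) => [|h2]; first by right.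
  by exfalso; apply: H'; exists t.
apply/negP => /crest_le[_ /(_ t tth)]; rewrite leNgt H1 leNgt H2; by case.
Qed.

Lemma le_ground c x y : (y <= ground c x) = (y <= wall c omega x) || (y <= wall c (pi / 2) x).
Proof. by rewrite /ground le_max. Qed.

Lemma le_crest c x y : (y <= crest c x) <-> (y <= ground c x \/
  exists2 t, t \in th & y <= wall c t x /\ y <= wall c (t + pi / 2) x).
Proof.
rewrite /crest le_bigmax_seqE; split=> [/orP[->|/hasP[t tth]]|[->//|[t tth [h1 h2]]]].
- by left.
- by rewrite le_min => /andP[h1 h2]; right; exists t.
- by apply/orP; right; apply/hasP; exists t; rewrite // le_min h1.
Qed.

Lemma ground_le_crest c x : ground c x <= crest c x.
Proof. by have /crest_le[] := lexx (crest c x). Qed.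

Lemma crest_wall c x : exists2 s, s \in normals & crest c x = wall c s x.
Proof.
have H t y z : Order.min y z = y \/ Order.min y z = z :> R.
  by rewrite minElt; case: ifP; [left|right].
pose P (z : R) := exists2 s, s \in normals & z = wall c s x.
suff : P (crest c x) by [].
rewrite /crest big_seq; elim/big_ind: _ => [|y z Py Pz|t tth].
- by rewrite /ground maxElt; case: ifP => _; [exists (pi / 2)|exists omega];
    rewrite ?pihalf_normal ?omega_normal.
- by rewrite maxElt; case: ifP.
- case: (H t (wall c t x) (wall c (t + pi / 2) x)) => ->.
    by exists t; rewrite ?theta_normal.
  by exists (t + pi / 2); rewrite ?theta_pihalf_normal.
Qed.

Lemma roof_line c x : exists2 s, s \in normals & roof c x = line (c s) s x.
Proof.
pose P (z : R) := exists2 s, s \in normals & z = line (c s) s x.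
suff : P (roof c x) by [].
rewrite /roof big_seq; elim/big_ind: _ => [|y z Py Pz|t tth].
- by exists (pi / 2); rewrite ?pihalf_normal.
- by rewrite minElt; case: ifP.
- by exists t.
Qed.

Lemma continuous_line d s : continuous (line d s).
Proof.
move=> x; rewrite /line; apply: cvgMl; apply: cvgB; first exact: cvg_cst.
by apply: cvgMl; exact: cvg_id.
Qed.

Lemma continuous_roof c : continuous (roof c).
Proof. by apply: continuous_bigmin => [|i _]; exact: continuous_line. Qed.

Lemma continuous_ground c : continuous (ground c).
Proof. by move=> x; apply: (@continuous_max R R); exact: continuous_line. Qed.

Lemma continuous_crest c : continuous (crest c).
Proof.
apply: continuous_bigmax => [|i _]; first exact: continuous_ground.
by move=> x; apply: (@continuous_min R R); exact: continuous_line.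
Qed.

Context (om : 0 < omega <= pi / 2) (thP : forall t, t \in th -> 0 < t < omega).

Lemma normals_range s : s \in normals -> 0 < s < pi.
Proof.
have pi0 := @pi_gt0 R; case/andP: om => o1 o2.
rewrite mem_normals => /or4P[/thP/andP[h1 h2]|/thP/andP[h1 h2]|/eqP->|/eqP->];
  apply/andP; split; lra.
Qed.

Lemma sin_normals s : s \in normals -> 0 < sin s.
Proof. by move/normals_range/sin_gt0_pi. Qed.

Lemma sin_omega : 0 < sin omega. Proof. exact/sin_normals/omega_normal. Qed.

Lemma cos_omega : 0 <= cos omega.
Proof.
have pi0 := @pi_gt0 R; case/andP: om => o1 o2.
by apply: cos_ge0_pihalf; apply/andP; split; lra.
Qed.

Lemma sin_pihalf_gt0 : 0 < sin (pi / 2) :> R. Proof. by rewrite sin_pihalf. Qed.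

Lemma theta_range t : t \in th -> 0 < t < pi / 2.
Proof. by move/thP; case/andP: om => _ + /andP[-> h]; exact: lt_le_trans. Qed.

Lemma sin_theta t : t \in th -> 0 < sin t.
Proof. by move/theta_normal/sin_normals. Qed.

Lemma cos_theta t : t \in th -> 0 < cos t.
Proof.
move=> /theta_range /andP[t0 t1]; apply: cos_gt0_pihalf.
by rewrite t1 andbT (lt_trans _ t0)// oppr_lt0 (lt_trans t0 t1).
Qed.

Lemma wall_up c x : wall c (pi / 2) x = c (pi / 2) - 1.
Proof. by rewrite /wall /line cos_pihalf sin_pihalf mulr0 subr0 divr1. Qed.

Lemma cone_ground c p : (c omega - 1 <= dot p (uvec omega) /\
  c (pi / 2) - 1 <= dot p (uvec (pi / 2))) <-> ground c p.1 <= p.2.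
Proof.
rewrite ground_le line_le_dot ?sin_omega// line_le_dot ?sin_pihalf_gt0//.
by split=> [[-> ->]|/andP[]].
Qed.

Lemma bodyP c p : body c p <-> ground c p.1 <= p.2 <= roof c p.1.
Proof.
split=> [[H1 H2 H3]|/andP[/cone_ground[H2 H3] /le_roof H1]].
  apply/andP; split; first exact/cone_ground.
  by apply/le_roof => s sn; rewrite -dot_le_line ?sin_normals// H1.
by split=> // s sn; rewrite dot_le_line ?sin_normals// H1.
Qed.

Lemma holeP c p : hole c p <-> ground c p.1 <= p.2 < crest c p.1.
Proof.
split=> [[H1 H2 [t tth [h1 h2]]]|/andP[fp /(lt_crest fp)[t tth [h1 h2]]]].
  have fp : ground c p.1 <= p.2 by exact/cone_ground.
  rewrite fp /=; apply/(lt_crest fp); exists t => //.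
  split; first by rewrite /wall -dot_lt_line//; exact/sin_normals/theta_normal.
  by rewrite /wall -dot_lt_line//; exact/sin_normals/theta_pihalf_normal.
have /cone_ground[H1 H2] := fp; split=> //; exists t => //.
split.
  by rewrite dot_lt_line; [exact: h1|exact/sin_normals/theta_normal].
by rewrite dot_lt_line; [exact: h2|exact/sin_normals/theta_pihalf_normal].
Qed.

End Profile.

(** * Areas and translations *)

Section Shift.
Context {R : realType}.
Local Notation lambda := (@lebesgue_measure R).

Lemma measurable_shift (a : R) :
  measurable_fun (setT : set (measurableTypeR R)) (fun x : R => x + a : measurableTypeR R).
Proof. by apply: continuous_measurable_fun => x; apply: cvgD; [exact: cvg_id|exact: cvg_cst]. Qed.

Lemma lebesgue_measure_shift (a : R) (A : set R) : measurable A ->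
  pushforward lambda (fun x : measurableTypeR R => x + a : measurableTypeR R) A = lambda A.
Proof.
move=> mA; have mf := measurable_shift a.
apply/esym/lebesgue_measure_unique => //= _ [[x y]] _ <-.
rewrite /pushforward.
rewrite [X in _ = lebesgue_measure X](_ : _ = `]x - a, y - a]%classic); last first.
  by apply/seteqP; split=> z /=; rewrite !in_itv/= ltrBlDr lerBrDr.
rewrite !lebesgue_measure_itv/= !lte_fin ltrD2r.
by case: ifP => // _; rewrite -!EFinB; congr EFin; ring.
Qed.

Lemma ge0_integral_shift (a : R) (f : R -> \bar R) :
  measurable_fun [set: R] f -> (forall x, 0 <= f x)%E ->
  (\int[lambda]_x f (x + a)%R = \int[lambda]_x f x)%E.
Proof.
move=> mf f0; have ms := measurable_shift a.
have := ge0_integral_pushforward ms lambda measurableT mf (fun x _ => f0 x).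
rewrite preimage_setT => <-.
by apply: eq_measure_integral => //= A mA AS; exact/lebesgue_measure_shift.
Qed.

(** Equality of minima is checked through their lower bounds, which avoids
    manipulating the iterated operators. *)
Lemma eq_from_le (a b : R) : (forall y, y <= a <-> y <= b) -> a = b.
Proof. by move=> H; apply/eqP; rewrite eq_le; apply/andP; split; apply/H. Qed.

Lemma eq_from_ge (a b : R) : (forall y, a <= y <-> b <= y) -> a = b.
Proof. by move=> H; apply/eqP; rewrite eq_le; apply/andP; split; apply/H. Qed.

End Shift.

Section Areas.
Context {R : realType} (omega : R) (th : seq R).
Context (om : 0 < omega <= pi / 2) (thP : forall t, t \in th -> 0 < t < omega).
Local Notation lambda := (@lebesgue_measure R).
Local Notation roof := (roof omega th).
Local Notation ground := (ground omega).
Local Notation crest := (crest omega th).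
Local Notation body := (body omega th).
Local Notation hole := (hole omega th).
Local Notation normals := (normals omega th).
Implicit Types (c : R -> R) (v : R * R) (x y : R).

Definition thickness c x : R := Order.max 0 (roof c x - ground c x).

Lemma thicknessE c x : thickness c x = Order.max 0 (roof c x - ground c x).
Proof. by []. Qed.

(** The product measure is by definition the integral of the lengths of the
    vertical sections. *)
Lemma area_body c : area (body c) = (\int[lambda]_x (thickness c x)%:E)%E.
Proof.
rewrite /area /product_measure1; apply: eq_integral => x _ /=.
rewrite (_ : xsection _ _ = `[ground c x, roof c x]%classic); last first.
  apply/seteqP; split=> y; rewrite /xsection /= inE.
    by move/(bodyP om thP); rewrite in_itv.
  by rewrite in_itv/= => H; apply/(bodyP om thP).
rewrite lebesgue_measure_itv/= lte_fin /thickness.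
case: ltP => h; last by rewrite max_l ?subr_le0.
by rewrite -EFinB max_r// subr_ge0 ltW.
Qed.

Lemma area_hole c : area (hole c) = (\int[lambda]_x (crest c x - ground c x)%:E)%E.
Proof.
rewrite /area /product_measure1; apply: eq_integral => x _ /=.
rewrite (_ : xsection _ _ = `[ground c x, crest c x[%classic); last first.
  apply/seteqP; split=> y; rewrite /xsection /= inE.
    by move/(holeP om thP); rewrite in_itv.
  by rewrite in_itv/= => H; apply/(holeP om thP).
rewrite lebesgue_measure_itv/= lte_fin.
have := ground_le_crest omega th c x.
by rewrite le_eqVlt => /orP[/eqP ->|->]; rewrite ?ltxx ?subrr.
Qed.

Lemma measurable_thickness c : measurable_fun [set: R] (EFin \o thickness c).
Proof.
apply/measurable_EFinP; apply: continuous_measurable_fun => x.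
apply: (@continuous_max R R (fun=> 0) (fun x => roof c x - ground c x)).
  exact: cvg_cst.
by apply: cvgB; [exact: continuous_roof|exact: continuous_ground].
Qed.

Lemma measurable_crestB c :
  measurable_fun [set: R] (fun x => (crest c x - ground c x)%:E).
Proof.
apply/measurable_EFinP; apply: continuous_measurable_fun => x.
by apply: cvgB; [exact: continuous_crest|exact: continuous_ground].
Qed.

Lemma thickness_ge0 c x : 0 <= thickness c x.
Proof. by rewrite /thickness le_max lexx. Qed.

Definition translated c v s := c s + dot v (uvec s).

Lemma wall_translated c v s x : s \in normals ->
  wall (translated c v) s (x + v.1) = wall c s x + v.2.
Proof.
move=> sn; rewrite /wall /translated addrAC line_translate//.
exact: sin_normals sn.
Qed.

Lemma roof_translated c v x : roof (translated c v) (x + v.1) = roof c x + v.2.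
Proof.
apply: eq_from_le => y; rewrite -lerBlDr !le_roof.
by split=> H s sn; have := H s sn;
  rewrite line_translate ?(sin_normals om thP)// lerBlDr.
Qed.

Lemma ground_translated c v x : ground (translated c v) (x + v.1) = ground c x + v.2.
Proof.
apply: eq_from_ge => y; rewrite -lerBrDr !ground_le.
by rewrite !wall_translated ?omega_normal ?pihalf_normal// !lerBrDr.
Qed.

Lemma crest_translated c v x : crest (translated c v) (x + v.1) = crest c x + v.2.
Proof.
apply: eq_from_ge => y; rewrite -lerBrDr !crest_le ground_translated lerBrDr.
split=> -[H1 H2]; split=> // t tth; have := H2 t tth;
  by rewrite !wall_translated ?theta_pihalf_normal ?theta_normal// -!lerBrDr.
Qed.

Lemma area_body_translated c v : area (body (translated c v)) = area (body c).
Proof.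
rewrite !area_body -(ge0_integral_shift v.1 (measurable_thickness _)); last first.
  by move=> x; rewrite lee_fin thickness_ge0.
apply: eq_integral => x _ /=.
rewrite /thickness roof_translated ground_translated; congr (Order.max _ _)%:E; ring.
Qed.

Lemma area_hole_translated c v : area (hole (translated c v)) = area (hole c).
Proof.
rewrite !area_hole -(ge0_integral_shift v.1 (measurable_crestB _)); last first.
  by move=> x; rewrite lee_fin subr_ge0 ground_le_crest.
apply: eq_integral => x _ /=.
rewrite crest_translated ground_translated; congr EFin; ring.
Qed.

End Areas.

(** * Support values of compact sets *)

Section Support.
Context {R : realType}.
Implicit Types (A : set (R * R)) (p q : R * R) (s : R).

Lemma continuous_dot q : continuous (fun p : R * R => dot p q).
Proof.
move=> p; rewrite /dot; apply: cvgD; apply: cvgMl; [exact: cvg_fst|exact: cvg_snd].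
Qed.

Lemma supp_eq A s p : A p -> (forall q, A q -> dot q (uvec s) <= dot p (uvec s)) ->
  supp A s = dot p (uvec s).
Proof.
move=> Ap H; apply/eqP; rewrite eq_le; apply/andP; split.
  by apply: ge_sup; [exists (dot p (uvec s)), p|move=> _ [q Aq <-]; exact: H].
apply: ub_le_sup; last by exists p.
by exists (dot p (uvec s)) => _ [q Aq <-]; exact: H.
Qed.

Lemma compact_dot_max A q : compact A -> A !=set0 ->
  exists2 p, A p & forall r, A r -> dot r q <= dot p q.
Proof.
move=> cA A0.
have cf : {within A, continuous (fun p => dot p q)}.
  by apply: continuous_subspaceT; exact: continuous_dot.
have [p pA H] := compact_EVT_max A0 cA cf.
by exists p; [rewrite inE in pA|move=> r rA; apply: H; rewrite inE].
Qed.

Lemma supp_attained A s : compact A -> A !=set0 ->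
  exists2 p, A p & dot p (uvec s) = supp A s.
Proof.
by move=> cA /(compact_dot_max (uvec s) cA)[p Ap H]; exists p => //; rewrite (supp_eq Ap H).
Qed.

Lemma le_supp A s p : compact A -> A p -> dot p (uvec s) <= supp A s.
Proof.
move=> cA Ap; have /(compact_dot_max (uvec s) cA)[q Aq H] : A !=set0 by exists p.
by rewrite (supp_eq Aq H); exact: H.
Qed.

Lemma closed_halfplane s d : closed (halfplane s d : set (R * R)).
Proof.
rewrite (_ : halfplane s d = (fun p => dot p (uvec s)) @^-1` [set x | x <= d])//.
by apply: closed_comp; [move=> p _; exact: continuous_dot|exact: closed_le].
Qed.

Lemma uvecDpi s : uvec (s + pi) = - uvec s :> R * R.
Proof. by rewrite /uvec cosDpi sinDpi. Qed.

Lemma dot_uvecDpi p s : dot p (uvec (s + pi)) = - dot p (uvec s).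
Proof. by rewrite uvecDpi /dot /=; ring. Qed.

Lemma threehalfpi : 3 * pi / 2 = pi / 2 + pi :> R.
Proof. by field. Qed.

Lemma halfplane_intersectionW (T T' : set R) A : T `<=` T' ->
  halfplane_intersection T A -> halfplane_intersection T' A.
Proof. by move=> TT' [S ST ->]; exists S => // a /ST/TT'. Qed.

(** Each half-plane that is used to cut out A contains the half-plane bounded by
    the supporting line with the same normal. *)
Lemma halfplane_intersection_supp (T : set R) A p : compact A -> A !=set0 ->
  halfplane_intersection T A ->
  A p <-> (forall t, T t -> dot p (uvec t) <= supp A t).
Proof.
move=> cA A0 [S ST AE]; split=> [Ap t _|H]; first exact: le_supp.
rewrite AE => a Sa; apply: le_trans (H _ (ST a Sa)) _.
have [q Aq <-] := supp_attained a.1 cA A0.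
by rewrite AE in Aq; exact: Aq.
Qed.

Lemma convex_set_from_comb A : (forall p q r, 0 <= r <= 1 -> A p -> A q -> A (r *: p + (1 - r) *: q)) ->
  convex_set A.
Proof.
move=> H p q r /set_mem Ap /set_mem Aq; apply/mem_set.
by apply: H => //; apply/andP; split.
Qed.

End Support.

(** * Polygon caps and their support values *)

Section CapProfile.
Context {R : realType} (omega : R) (th : seq R).
Context (om : 0 < omega <= pi / 2) (thP : forall t, t \in th -> 0 < t < omega).
Local Notation body := (body omega th).
Local Notation hole := (hole omega th).
Local Notation normals := (normals omega th).
Local Notation Theta := [set` th].
Implicit Types (c : R -> R) (v p : R * R) (x y s t : R).

(** All side lines given by c touch [body c]. This makes c the support function
    of [body c] on the diamond and is invariant under translation, unlike being
    the profile of a normalized cap. *)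
Definition cap_profile c :=
  [/\ forall s, s \in normals -> exists2 p, body c p & dot p (uvec s) = c s,
    exists2 p, body c p & dot p (uvec omega) = c omega - 1 &
    exists2 p, body c p & dot p (uvec (pi / 2)) = c (pi / 2) - 1].

Definition body_constraints c : set (R * R) :=
  [set a | a.1 \in normals /\ a.2 = c a.1] `|`
  [set (omega + pi, 1 - c omega); (3 * pi / 2, 1 - c (pi / 2))].

Lemma body_bigcap c : body c = \bigcap_(a in body_constraints c) halfplane a.1 a.2.
Proof.
apply/seteqP; split=> p.
  case=> H1 H2 H3 a [[an ->]|[->|->]] /=; first exact: H1.
    by rewrite /halfplane /= dot_uvecDpi; lra.
  by rewrite /halfplane /= threehalfpi dot_uvecDpi; lra.
move=> H; split=> [s sn||].
- by apply: (H (s, c s)); left.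
- have : halfplane (omega + pi) (1 - c omega) p by apply: (H (_, _)); right; left.
  by rewrite /halfplane /= dot_uvecDpi; lra.
- have : halfplane (3 * pi / 2) (1 - c (pi / 2)) p by apply: (H (_, _)); right; right.
  by rewrite /halfplane /= threehalfpi dot_uvecDpi; lra.
Qed.

Lemma closed_body c : closed (body c).
Proof. by rewrite body_bigcap; apply: closed_bigI => a _; exact: closed_halfplane. Qed.

(** One quadrant of normals t and t + pi / 2, together with the horizontal
    strip, already bounds the cap. *)
Lemma body_bounded c t p : t \in th -> body c p ->
  [/\ c (pi / 2) - 1 <= p.2 <= c (pi / 2),
   ((c (pi / 2) - 1) * cos t - c (t + pi / 2)) / sin t <= p.1 &
   p.1 <= (c t - (c (pi / 2) - 1) * sin t) / cos t].
Proof.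
move=> tth [H1 _ H3]; have st := sin_theta om thP tth; have ct := cos_theta om thP tth.
move: H3; rewrite dot_up => H3.
have := H1 _ (pihalf_normal omega th); rewrite dot_up => H4.
have := H1 _ (theta_normal omega tth); rewrite dot_uvec => H5.
have := H1 _ (theta_pihalf_normal omega tth); rewrite uvec_pihalf /dot /= => H6.
split; first by rewrite H3.
  by rewrite ler_pdivrMr//; nra.
by rewrite ler_pdivlMr//; nra.
Qed.

Lemma compact_body c : th != [::] -> compact (body c).
Proof.
case: th body_bounded closed_body => // t l HB HC _.
apply: (@subclosed_compact _ _ (`[((c (pi / 2) - 1) * cos t - c (t + pi / 2)) / sin t,
    (c t - (c (pi / 2) - 1) * sin t) / cos t]%classic `*` `[c (pi / 2) - 1, c (pi / 2)]%classic)).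
- exact: HC.
- by apply: compact_setX; exact: segment_compact.
- move=> p /(HB c t p (mem_head _ _))[h1 h2 h3]; split; rewrite /= in_itv/= ?h1//.
  by rewrite h2 h3.
Qed.

Lemma convex_body_comb c p q r : 0 <= r <= 1 -> body c p -> body c q ->
  body c (r *: p + (1 - r) *: q).
Proof.
case/andP => r0 r1 [p1 p2 p3] [q1 q2 q3]; split=> [s sn||];
  rewrite dot_uvecD !dot_uvecZ.
- have := p1 s sn; have := q1 s sn; nra.
- nra.
- nra.
Qed.

Lemma diamondE t : diamond omega Theta t <-> t \in normals.
Proof.
rewrite mem_normals; split.
  case=> [[tth|[u uth <-]]|[->|->]]; rewrite ?eqxx ?orbT//.
    by rewrite (tth : _ \in _).
  by rewrite addrK (uth : _ \in _) orbT.
case/or4P => [tth|tth|/eqP ->|/eqP ->].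
- by left; left.
- by left; right; exists (t - pi / 2); rewrite ?subrK.
- by right; left.
- by right; right.
Qed.

Lemma diamond_cap_angles : diamond omega Theta `|` [set omega + pi; 3 * pi / 2] `<=`
  `[0, omega] `|` `[pi / 2, omega + pi / 2] `|` [set omega + pi; 3 * pi / 2].
Proof.
have pi0 := @pi_gt0 R; case/andP: om => o1 o2.
move=> t [/diamondE|]; last by right.
rewrite mem_normals => /or4P[/thP/andP[h1 h2]|/thP/andP[h1 h2]|/eqP->|/eqP->]; left.
- by left; rewrite /= in_itv/=; apply/andP; split; lra.
- by right; rewrite /= in_itv/=; apply/andP; split; lra.
- by left; rewrite /= in_itv/=; apply/andP; split; lra.
- by right; rewrite /= in_itv/=; apply/andP; split; lra.
Qed.

Lemma supp_body c s : cap_profile c -> s \in normals -> supp (body c) s = c s.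
Proof.
move=> [H _ _] sn; have [p bp E] := H s sn.
by rewrite -E; apply: supp_eq => // q [/(_ s sn)]; rewrite E.
Qed.

Lemma polygon_cap_body c : th != [::] -> cap_profile c -> c omega = 1 -> c (pi / 2) = 1 ->
  polygon_cap omega Theta (body c).
Proof.
move=> th0 cP c1 c2; have [H1 [a ba Ea] [b bb Eb]] := cP.
have HI : halfplane_intersection
    (diamond omega Theta `|` [set omega + pi; 3 * pi / 2]) (body c).
  exists (body_constraints c); last exact: body_bigcap.
  move=> d [[dn _]|[->|->]]; [left; exact/diamondE|by right; left|by right; right].
split=> //; split.
- split; [by exists a|exact: compact_body|].
  by apply: convex_set_from_comb => p q r; exact: convex_body_comb.
- by rewrite !supp_body ?omega_normal ?pihalf_normal.
- split.
    rewrite (@supp_eq _ _ _ a)// ?dot_uvecDpi ?Ea ?c1; first by lra.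
    by move=> q [_ q2 _]; rewrite dot_uvecDpi; lra.
  rewrite threehalfpi (@supp_eq _ _ _ b)// ?dot_uvecDpi ?Eb ?c2; first by lra.
  by move=> q [_ _ q2]; rewrite dot_uvecDpi; lra.
- exact: halfplane_intersectionW diamond_cap_angles HI.
Qed.

Lemma hole_niche K : supp K omega = 1 -> supp K (pi / 2) = 1 ->
  niche omega Theta K = hole (supp K).
Proof.
move=> K1 K2; apply/seteqP; split=> p; rewrite /hole /= K1 K2 subrr.
  by case=> -[p1 p2] [t tth [q1 q2]]; split=> //; exists t; rewrite ?uvec_pihalf.
by case=> p1 p2 [t tth [q1]]; rewrite uvec_pihalf => q2; split=> //; exists t.
Qed.

(** The lower sides and the angles of the diamond are the only normals of a
    polygon cap, so its support values determine it. *)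
Lemma cap_polygon K : polygon_cap omega Theta K ->
  [/\ K = body (supp K), cap_profile (supp K), supp K omega = 1 & supp K (pi / 2) = 1].
Proof.
case=> -[[K0 cK _] [K1 K2] [K3 K4] _] HI.
have KE : K = body (supp K).
  apply/seteqP; split=> p.
    move=> Kp; split=> [s _||]; first exact: le_supp.
      by have := le_supp (omega + pi) cK Kp; rewrite K3 K1 dot_uvecDpi; lra.
    by have := le_supp (3 * pi / 2) cK Kp; rewrite K4 K2 threehalfpi dot_uvecDpi; lra.
  case=> p1 p2 p3; apply/(halfplane_intersection_supp p cK K0 HI) => t.
  case=> [/diamondE/p1//|[->|->]].
    by rewrite K3 dot_uvecDpi; lra.
  by rewrite K4 threehalfpi dot_uvecDpi; lra.
split=> //; split.
- by move=> s _; have [p Kp E] := supp_attained s cK K0; exists p; rewrite -?KE.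
- have [p Kp] := supp_attained (omega + pi) cK K0.
  by rewrite K3 dot_uvecDpi K1 => E; exists p; rewrite -?KE//; lra.
- have [p Kp] := supp_attained (3 * pi / 2) cK K0.
  by rewrite K4 threehalfpi dot_uvecDpi K2 => E; exists p; rewrite -?KE//; lra.
Qed.

Lemma body_translated c v p : body (translated c v) (p + v) <-> body c p.
Proof.
rewrite /body /= /translated; split=> -[H1 H2 H3]; split=> [s sn||].
- by have := H1 s sn; rewrite dot_uvecD; lra.
- by move: H2; rewrite dot_uvecD; lra.
- by move: H3; rewrite dot_uvecD; lra.
- by have := H1 s sn; rewrite dot_uvecD; lra.
- by move: H2; rewrite dot_uvecD; lra.
- by move: H3; rewrite dot_uvecD; lra.
Qed.

Lemma cap_profile_translated c v : cap_profile c -> cap_profile (translated c v).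
Proof.
case=> H1 [a ba Ea] [b bb Eb]; split.
- move=> s /H1[p bp E]; exists (p + v); first exact/body_translated.
  by rewrite dot_uvecD E.
- by exists (a + v); rewrite ?body_translated// dot_uvecD Ea /translated; lra.
- by exists (b + v); rewrite ?body_translated// dot_uvecD Eb /translated; lra.
Qed.

(** A translation can move the two lower sides by any prescribed amounts, and
    its length is controlled by them. When omega = pi / 2 the two sides are the
    same line, hence the compatibility condition. *)
Lemma prescribed_dot : exists2 C, 0 <= C & forall al be : R,
  (omega = pi / 2 -> al = be) -> 0 <= al -> 0 <= be ->
  exists v : R * R, [/\ dot v (uvec omega) = al, dot v (uvec (pi / 2)) = be &
    forall s, `|dot v (uvec s)| <= C * (al + be)].
Proof.
have cw := cos_omega om; have sw := sin_omega om thP.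
have sw1 := sin_le1 omega.
have key v s : `|dot v (uvec s)| <= `|v.1| + `|v.2| :> R.
  rewrite dot_uvec; apply: le_trans (ler_normD _ _) _; rewrite !normrM.
  have := cos_max s; have := sin_max s; have := normr_ge0 v.1; have := (normr_ge0 v.2).
  by nra.
have [ow|ow] := eqVneq omega (pi / 2).
  exists 1 => // al be /(_ ow) -> _ b0; exists (0, be).
  rewrite ow dot_up /=; split=> // s; apply: le_trans (key _ _) _ => /=.
  by rewrite normr0 ger0_norm//; lra.
have c0 : 0 < cos omega.
  have pi0 := @pi_gt0 R; case/andP: om => o1 o2; apply: cos_gt0_pihalf.
  have o3 : omega < pi / 2 by rewrite lt_neqAle ow o2.
  by rewrite o3 andbT; lra.
exists ((cos omega)^-1 + 1); first by rewrite addr_ge0// invr_ge0 ltW.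
move=> al be _ a0 b0; exists ((al - be * sin omega) / cos omega, be); split.
- by rewrite dot_uvec /=; field; rewrite gt_eqF.
- by rewrite dot_up.
- move=> s; apply: le_trans (key _ _) _ => /=.
  have N : `|(al - be * sin omega) / cos omega| <= (cos omega)^-1 * (al + be).
    rewrite normrM [`|_^-1|]ger0_norm ?invr_ge0 ?(ltW c0)// mulrC.
    rewrite ler_wpM2l ?invr_ge0 ?(ltW c0)//.
    by rewrite ler_norml; apply/andP; split; nra.
  by rewrite (ger0_norm b0); move: N; set X := `|_|; set Y := _^-1; lra.
Qed.

End CapProfile.

(** * Cutting a cap along one side *)

Lemma seq_lower_bound {R : realType} {I : eqType} (l : seq I) (F : I -> R) :
  (forall i, i \in l -> 0 < F i) -> exists2 k, 0 < k & forall i, i \in l -> k <= F i.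
Proof.
elim: l => [|i l IH] H; first by exists 1.
have [j jl|k k0 kH] := IH; first by apply: H; rewrite inE jl orbT.
exists (Order.min k (F i)); first by rewrite lt_min k0 H ?mem_head.
move=> j; rewrite inE ge_min => /predU1P[->|/kH->//]; by rewrite lexx orbT.
Qed.

Lemma seq_upper_bound {R : realType} {I : eqType} (l : seq I) (F : I -> R) :
  exists2 k, 0 <= k & forall i, i \in l -> F i <= k.
Proof.
elim: l => [|i l [k k0 kH]]; first by exists 0.
exists (Order.max k (F i)); first by rewrite le_max k0.
move=> j; rewrite inE le_max => /predU1P[->|/kH->//]; by rewrite lexx orbT.
Qed.

Section Cut.
Context {R : realType} (omega : R) (th : seq R).
Context (om : 0 < omega <= pi / 2) (thP : forall t, t \in th -> 0 < t < omega).
Local Notation body := (body omega th).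
Local Notation hole := (hole omega th).
Local Notation normals := (normals omega th).
Local Notation cap_profile := (cap_profile omega th).
Local Notation Theta := [set` th].
Implicit Types (c : R -> R) (v p : R * R) (x y s t : R).

Lemma eq_hole c c' : (forall s, s \in normals -> c s = c' s) -> hole c = hole c'.
Proof.
move=> E; apply/seteqP; split=> p [p1 p2 [t tth [q1 q2]]]; split.
- by rewrite -E ?omega_normal.
- by rewrite -E ?pihalf_normal.
- by exists t => //; rewrite -!E ?theta_pihalf_normal ?theta_normal.
- by rewrite E ?omega_normal.
- by rewrite E ?pihalf_normal.
- by exists t => //; rewrite !E ?theta_pihalf_normal ?theta_normal.
Qed.

(** After a translation every profile competes with K, and translations preserve
    areas. The inequality between differences of areas is written with sums
    because the areas are extended reals. *)
Lemma maximum_cap_le K c : th != [::] -> maximum_polygon_cap omega Theta K ->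
  cap_profile c -> c omega <= 1 -> c (pi / 2) <= 1 ->
  (area (hole c) < +oo)%E -> (area (hole (supp K)) < +oo)%E ->
  (area (body c) + area (hole (supp K)) <= area K + area (hole c))%E.
Proof.
move=> th0 [Kcap _ Kmax] cP c1 c2 fc fK.
have [KE KP K1 K2] := cap_polygon Kcap.
have [C _ /(_ (1 - c omega) (1 - c (pi / 2)))[|||v [v1 v2 _]]] := prescribed_dot om thP.
- by move=> ->.
- by rewrite subr_ge0.
- by rewrite subr_ge0.
pose d := translated c v.
have d1 : d omega = 1 by rewrite /d /translated v1; lra.
have d2 : d (pi / 2) = 1 by rewrite /d /translated v2; lra.
have dP : cap_profile d by exact: cap_profile_translated.
have := Kmax _ (polygon_cap_body om thP th0 dP d1 d2).
rewrite /sofa_area !hole_niche ?(supp_body dP) ?omega_normal ?pihalf_normal//.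
rewrite (@eq_hole (supp (body d)) d); last by move=> s; exact: supp_body.
rewrite area_hole_translated// area_body_translated//.
have g0 c' : (0 <= area (hole c'))%E.
  rewrite area_hole//; apply: integral_ge0 => x _.
  by rewrite lee_fin subr_ge0 ground_le_crest.
rewrite leeBlDr ?ge0_fin_numE//.
rewrite -addeAC leeBrDr ?ge0_fin_numE//.
Qed.

(** A point on both lower sides that is strictly inside all upper half-planes:
    the apex of the fan when omega < pi / 2, and the foot of a highest point of
    the cap when omega = pi / 2. Strictness lets the cap be perturbed so that
    its lower sides still touch it. *)
Lemma cap_anchor c : cap_profile c -> c omega = 1 -> c (pi / 2) = 1 ->
  exists z, [/\ dot z (uvec omega) = 0, dot z (uvec (pi / 2)) = 0 &
    forall s, s \in normals -> dot z (uvec s) < c s].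
Proof.
move=> [H1 _ _] c1 c2; have pi0 := @pi_gt0 R; case/andP: (om) => om1 om2.
have [q bq] := H1 _ (pihalf_normal omega th); rewrite dot_up c2 => Eq.
have [ow|ow] := eqVneq omega (pi / 2).
  exists (q.1, 0); split=> [||s sn]; rewrite ?ow ?dot_up//.
  have [/(_ s sn) + _ _] := bq; have := sin_normals om thP sn.
  by rewrite !dot_uvec Eq /=; lra.
have ow' : omega < pi / 2 by rewrite lt_neqAle ow.
have cw : 0 < cos omega by apply: cos_gt0_pihalf; rewrite ow' andbT; lra.
exists 0; split; [by rewrite dot_uvec /=; ring|by rewrite dot_uvec /=; ring|].
have dot0 s : dot 0 (uvec s) = 0 :> R by rewrite dot_uvec /=; ring.
have [p bp Ep] := H1 _ (omega_normal omega th).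
move=> s sn; rewrite dot0; have := sn; rewrite mem_normals => /or4P[tth|tth|/eqP->|/eqP->]; last 2 first.
- by rewrite c1.
- by rewrite c2.
- have [/(_ s sn) h1 _ _] := bp; apply: lt_le_trans h1.
  have [/(_ _ (pihalf_normal omega th)) h2 _ _] := bp.
  move: h2; rewrite dot_up c2 => h2.
  have /andP[s0 s1] := thP tth.
  have : sin (omega - s) < sin (pi / 2 - s).
    by rewrite ltr_sin ?in_itv/= ?ltrD2r//; apply/andP; split; lra.
  rewrite [sin (pi / 2 - s)]sinB sin_pihalf cos_pihalf mul1r mul0r subr0 => h3.
  have h4 : 0 < sin (omega - s) by apply: sin_gt0_pi; apply/andP; split; lra.
  move: Ep; rewrite c1 !dot_uvec => Ep.
  rewrite -(pmulr_rgt0 _ cw).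
  (* cos omega * u_s = cos s * u_omega - sin (omega - s) * u_(pi / 2) *)
  have -> : cos omega * (p.1 * cos s + p.2 * sin s) =
    (p.1 * cos omega + p.2 * sin omega) * cos s - p.2 * sin (omega - s).
    by rewrite sinB; ring.
  by rewrite Ep; nra.
- have [/(_ s sn) h1 _ _] := bq; apply: lt_le_trans h1.
  have [/(_ _ (omega_normal omega th)) h2 _ _] := bq.
  move: h2; rewrite c1 => h2.
  set t := s - pi / 2 in tth; have st : s = t + pi / 2 by rewrite subrK.
  have /andP[s0 s1] := thP tth.
  have : sin t < sin (t + pi / 2 - omega).
    by rewrite ltr_sin ?in_itv/= -?addrA ?ltrDl//; try (apply/andP; split); lra.
  rewrite addrAC sinDpihalf => h3.
  have h4 : 0 < sin t by apply: sin_gt0_pi; apply/andP; split; lra.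
  rewrite st uvec_pihalf /dot /= Eq mul1r.
  move: h2; rewrite dot_uvec Eq mul1r => h2.
  rewrite -(pmulr_rgt0 _ cw).
  (* cos omega * v_t = cos (omega - t) * u_(pi / 2) - sin t * u_omega *)
  have -> : cos omega * (q.1 * - sin t + cos t) =
    cos (t - omega) - (q.1 * cos omega + sin omega) * sin t.
    by rewrite cosB; ring.
  by nra.
Qed.

(** The new support values d are those of the part of the cap that remains after
    cutting. Moving a touching point towards the anchor by a proportion O(e)
    brings it into that part, so d differs from c by O(e). The anchor,
    translated onto the receded lower sides, remains inside all upper half-
    planes for small e; hence these sides touch as well. *)
Lemma cut_profile c t : th != [::] ->
  cap_profile c -> c omega = 1 -> c (pi / 2) = 1 -> t \in normals ->
  exists C e0, [/\ 0 < C, 0 < e0 & forall e, 0 < e < e0 -> exists d,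
    [/\ cap_profile d, forall s, s \in normals -> c s - C * e <= d s <= c s,
      d t <= c t - e &
      forall p, body c p -> dot p (uvec t) <= c t - e ->
        forall s, s \in normals -> dot p (uvec s) <= d s]].
Proof.
move=> th0 cP c1 c2 tn; have [H1 H2 H3] := cP.
have [z [z1 z2 zH]] := cap_anchor cP c1 c2.
have [k k0 kH] : exists2 k, 0 < k & forall s, s \in normals -> k <= c s - dot z (uvec s).
  by apply: seq_lower_bound => s /zH; rewrite subr_gt0.
have [D D0 DH] := seq_upper_bound normals (fun s => c s - dot z (uvec s)).
have [C2 C20 C2H] := prescribed_dot om thP.
(* The support values drop by at most C1 * e, which the translation of the
   anchor amplifies to at most C2 * (C1 + C1) * e; B adds the cut itself. *)
pose C1 := D / k; have C10 : 0 <= C1 by rewrite divr_ge0// ltW.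
pose B := C1 + C2 * (C1 + C1) + 1.
have B0 : 0 < B.
  by rewrite /B; have : 0 <= C2 * (C1 + C1); [rewrite mulr_ge0// addr_ge0|lra].
exists (C1 + 1), (Order.min k (k / B)); split.
- by lra.
- by rewrite lt_min k0 divr_gt0.
move=> e /andP[e0]; rewrite lt_min ltr_pdivlMr// => /andP[ek eB].
pose A := body c `&` halfplane t (c t - e).
have zb : body c z.
  by split=> [s /zH/ltW//||]; rewrite ?z1 ?z2 ?c1 ?c2 subrr.
have A0 : A !=set0 by exists z; split=> //; rewrite /halfplane /=; have := kH t tn; lra.
have cA : compact A.
  apply: (@subclosed_compact _ _ (body c)); [|exact: compact_body|by move=> p []].
  by apply: closedI; [exact: closed_body|exact: closed_halfplane].
pose d := supp A.
have dle s : s \in normals -> d s <= c s.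
  by move=> sn; rewrite /d; have [p [[pH _ _] _] <-] := supp_attained s cA A0; exact: pH.
have dge s : s \in normals -> c s - C1 * e <= d s.
  move=> sn; have [p bp Ep] := H1 s sn.
  pose r := e / k; have r01 : 0 <= r <= 1.
    by rewrite divr_ge0 ?(ltW e0) ?(ltW k0)//= ler_pdivrMr// mul1r ltW.
  have rk : r * k = e by rewrite /r divfK ?gt_eqF.
  have Ap : A (r *: z + (1 - r) *: p).
    split; first exact: convex_body_comb.
    rewrite /halfplane /= dot_uvecD !dot_uvecZ.
    have [/(_ t tn) h _ _] := bp; have := kH t tn; case/andP: r01 => r0 r1; nra.
  apply: le_trans (le_supp s cA Ap).
  rewrite dot_uvecD !dot_uvecZ Ep.
  have -> : C1 * e = r * D by rewrite /C1 /r; field; rewrite gt_eqF.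
  have := DH s sn; case/andP: r01 => r0 r1; nra.
have Ad p : A p -> body d p.
  move=> Ap; split=> [s _||]; first exact: le_supp.
    have [[_ h _] _] := Ap; apply: le_trans h; rewrite lerB//.
    by rewrite dle ?omega_normal.
  have [[_ _ h] _] := Ap; apply: le_trans h; rewrite lerB//.
  by rewrite dle ?pihalf_normal.
(* One point for both lower sides: the anchor moved along with them. *)
have lowest : exists2 p, body d p &
    dot p (uvec omega) = d omega - 1 /\ dot p (uvec (pi / 2)) = d (pi / 2) - 1.
  have ow := omega_normal omega th; have ph := pihalf_normal omega th.
  have [|||v [v1 v2 vH]] := C2H (1 - d omega) (1 - d (pi / 2)).
  - by move=> ->.
  - by have := dle _ ow; rewrite c1; lra.
  - by have := dle _ ph; rewrite c2; lra.
  exists (z - v); last by rewrite !dot_uvecB z1 z2 v1 v2; split; lra.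
  split=> [s sn||]; rewrite dot_uvecB ?z1 ?z2 ?v1 ?v2; [|lra|lra].
  have : - dot v (uvec s) <= C2 * (C1 * e + C1 * e).
    apply: le_trans (ler_norm _) _; rewrite normrN; apply: le_trans (vH s) _.
    rewrite ler_wpM2l// lerD//.
      by have := dge _ ow; rewrite c1; lra.
    by have := dge _ ph; rewrite c2; lra.
  have := kH s sn; have := dge s sn; rewrite /B in eB; lra.
exists d; split.
- split=> [s sn||].
  + by have [p Ap E] := supp_attained s cA A0; exists p => //; exact: Ad.
  + by case: lowest => p bp [E _]; exists p.
  + by case: lowest => p bp [_ E]; exists p.
- move=> s sn; rewrite dle// andbT; apply: le_trans (dge s sn).
  by rewrite lerD2l lerN2 ler_pM2r//; lra.
- by rewrite /d; have [p [_ pt] <-] := supp_attained t cA A0.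
- by move=> p bp pt s _; apply: le_supp.
Qed.

End Cut.

(** * The two ends of the lower boundary *)

Section Ends.
Context {R : realType} (omega : R) (th : seq R).
Context (om : 0 < omega <= pi / 2) (thP : forall t, t \in th -> 0 < t < omega).
Context (th0 : th != [::]).
Local Notation roof := (roof omega th).
Local Notation ground := (ground omega).
Local Notation body := (body omega th).
Local Notation normals := (normals omega th).
Local Notation cap_profile := (cap_profile omega th).
Implicit Types (v p : R * R) (x y s t : R).
Context (c : R -> R) (cP : cap_profile c) (c1 : c omega = 1) (c2 : c (pi / 2) = 1).

(** The vertex of [vplus_left_end]. It lies on the line through the origin in
    direction v_omega, so the support value in that direction determines it. *)
Definition left_end : R * R := supp (body c) (omega + pi / 2) *: vvec omega.
Definition right_end : R * R := (supp (body c) 0, 0).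
Local Notation a1 := left_end.1.
Local Notation b1 := right_end.1.

Lemma body_nonempty : body c !=set0.
Proof. by case: cP => _ [p bp _] _; exists p. Qed.

Let cB : compact (body c) := compact_body om thP th0.

Lemma dot_frame p s : dot p (uvec s) =
  dot p (uvec omega) * cos (s - omega) + dot p (vvec omega) * sin (s - omega).
Proof.
rewrite cosB sinB !dot_uvec /dot /=.
transitivity ((cos omega ^+ 2 + sin omega ^+ 2) * (p.1 * cos s + p.2 * sin s)); last by ring.
by rewrite cos2Dsin2 mul1r.
Qed.

Lemma fst_frame p : p.1 = dot p (uvec omega) * cos omega - dot p (vvec omega) * sin omega.
Proof. by have := dot_frame p 0; rewrite dot_right sub0r cosN sinN => ->; ring. Qed.

Lemma dot_vv : dot (vvec omega) (vvec omega) = 1 :> R.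
Proof. by rewrite /dot /= -(cos2Dsin2 omega); ring. Qed.

Lemma dot_vu : dot (vvec omega) (uvec omega) = 0 :> R.
Proof. by rewrite /dot /=; ring. Qed.

Lemma left_end_ground : dot left_end (uvec omega) = 0.
Proof. by rewrite dot_uvecZ dot_vu mulr0. Qed.

Lemma left_end_v : dot left_end (vvec omega) = supp (body c) (omega + pi / 2).
Proof. by rewrite -uvec_pihalf dot_uvecZ uvec_pihalf dot_vv mulr1. Qed.

Lemma left_end_max p : body c p -> dot p (vvec omega) <= supp (body c) (omega + pi / 2).
Proof. by move=> bp; rewrite -uvec_pihalf; exact: le_supp. Qed.

Lemma normal_cos s : s \in normals -> 0 <= cos (s - omega).
Proof.
have pi0 := @pi_gt0 R; case/andP: om => o1 o2.
move=> sn; apply: cos_ge0_pihalf; move: sn.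
rewrite mem_normals => /or4P[/thP/andP[h1 h2]|/thP/andP[h1 h2]|/eqP->|/eqP->];
  apply/andP; split; lra.
Qed.

(** Sliding a point of the cap in the direction -u_omega decreases its products
    with all u_s of the diamond, as these make an angle at most pi / 2 with
    u_omega. So the point of the lower line with the largest product with
    v_omega stays in the cap. *)
Lemma body_left_end : body c left_end.
Proof.
have cw := cos_omega om; have sw := sin_omega om thP.
have [p bp] := supp_attained (omega + pi / 2) cB body_nonempty.
rewrite uvec_pihalf => Ep.
have [H1 [q bq Eq] _] := cP.
split=> [s sn||].
- have [/(_ s sn) + p2 _] := bp; apply: le_trans.
  rewrite [leLHS]dot_frame [leRHS]dot_frame left_end_ground left_end_v Ep lerD2r mul0r.
  by rewrite mulr_ge0// ?normal_cos//; move: p2; rewrite c1 subrr.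
- by rewrite left_end_ground c1 subrr.
- rewrite c2 subrr dot_frame left_end_ground left_end_v mul0r add0r.
  rewrite sinB sin_pihalf cos_pihalf mul1r mul0r subr0.
  have [_ _] := bq; rewrite c2 subrr dot_frame Eq c1 subrr mul0r add0r.
  rewrite sinB sin_pihalf cos_pihalf mul1r mul0r subr0 => h.
  by apply: le_trans h _; rewrite ler_wpM2r// left_end_max.
Qed.

Lemma right_end_max p : body c p -> p.1 <= b1.
Proof. by move=> bp; rewrite -dot_right; exact: le_supp. Qed.

Lemma body_right_end : body c right_end.
Proof.
have cw := cos_omega om.
have [p bp] := supp_attained 0 cB body_nonempty; rewrite dot_right => Ep.
have [H1 _ [q bq]] := cP; rewrite dot_up c2 subrr => Eq.
split=> [s sn||].
- have [/(_ s sn) + _] := bp; rewrite dot_up c2 subrr => + p3; apply: le_trans.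
  rewrite !dot_uvec /= Ep mul0r lerD2l mulr_ge0// ltW//.
  exact: sin_normals sn.
- have [_ + _] := bq; rewrite c1 subrr !dot_uvec Eq mul0r addr0 /= => h.
  apply: le_trans h _; have := right_end_max bq; rewrite /= => h; nra.
- by rewrite c2 subrr dot_up.
Qed.

Lemma left_end_min p : body c p -> a1 <= p.1.
Proof.
have cw := cos_omega om; have sw := sin_omega om thP.
move=> bp; rewrite [leLHS]fst_frame [leRHS]fst_frame.
rewrite left_end_ground left_end_v mul0r.
have := left_end_max bp; have [_ + _] := bp; rewrite c1 subrr; nra.
Qed.

Lemma ends_le : a1 <= b1.
Proof. exact: left_end_min body_right_end. Qed.

Lemma body_above x : a1 <= x <= b1 -> exists2 p, body c p & p.1 = x.
Proof.
move=> /andP[ax xb].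
have [ab|ab] := eqVneq a1 b1.
  by exists left_end; [exact: body_left_end|apply/eqP; rewrite eq_le ax ab xb].
have ab' : 0 < b1 - a1 by rewrite subr_gt0 lt_neqAle ab ends_le.
pose r := (b1 - x) / (b1 - a1).
exists (r *: left_end + (1 - r) *: right_end).
  apply: convex_body_comb body_left_end body_right_end.
  by rewrite divr_ge0 ?(ltW ab') ?subr_ge0//= ler_pdivrMr// mul1r lerB.
transitivity (r * a1 + (1 - r) * b1) => //; rewrite /r.
move: (a1) (b1) ab' => a b ab'.
by field; rewrite gt_eqF.
Qed.

(** The cap projects onto the interval between the abscissas of its two ends,
    which are its leftmost and rightmost points. *)
Lemma ground_le_roof x : (ground c x <= roof c x) = (a1 <= x <= b1).
Proof.
apply/idP/idP => [H|/body_above[p bp <-]].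
  have bp : body c (x, ground c x) by apply/(bodyP om thP); rewrite /= lexx.
  by rewrite (left_end_min bp) (right_end_max bp).
by have /(bodyP om thP)/andP[] := bp; exact: le_trans.
Qed.

Lemma cap_interior : exists m, [/\ forall s, s \in normals -> dot m (uvec s) < c s,
  0 < dot m (uvec omega) & 0 < dot m (uvec (pi / 2))].
Proof.
have [z [z1 z2 zH]] := cap_anchor om thP cP c1 c2.
have [k k0 kH] : exists2 k, 0 < k & forall s, s \in normals -> k <= c s - dot z (uvec s).
  by apply: seq_lower_bound => s /zH; rewrite subr_gt0.
exists (z + (0, k / 2)); split=> [s sn||]; rewrite dot_uvecD ?z1 ?z2 ?add0r.
- have := kH s sn; have := sin_normals om thP sn; have := sin_le1 s.
  rewrite [dot (0, _) _]dot_uvec /=; nra.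
- by rewrite dot_uvec /= mul0r add0r mulr_gt0// ?divr_gt0//; exact: (sin_omega om thP).
- by rewrite dot_up /= divr_gt0.
Qed.

(** Every interior abscissa is that of a point on a segment from an end of the
    cap to an interior point. *)
Lemma ground_lt_roof x : a1 < x < b1 -> ground c x < roof c x.
Proof.
move=> /andP[ax xb]; have [m [m1 m2 m3]] := cap_interior.
suff [p [p1 p2 p3] <-] : exists2 p, [/\ forall s, s \in normals -> dot p (uvec s) < c s,
  0 < dot p (uvec omega) & 0 < dot p (uvec (pi / 2))] & p.1 = x.
  apply: (@lt_trans _ _ p.2).
    rewrite groundE gt_max /wall c1 c2 subrr -!line_lt_dot ?p2 ?p3 ?sin_pihalf_gt0//.
    exact: (sin_omega om thP).
  have [s sn ->] := roof_line omega th c p.1.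
  by rewrite -dot_lt_line ?p1//; exact: sin_normals sn.
have key q r : body c q -> 0 < r <= 1 -> exists2 p, [/\ forall s, s \in normals -> dot p (uvec s) < c s,
  0 < dot p (uvec omega) & 0 < dot p (uvec (pi / 2))] & p.1 = r * m.1 + (1 - r) * q.1.
  case=> q1; rewrite c1 c2 subrr => q2 q3 /andP[r0 r1].
  exists (r *: m + (1 - r) *: q) => //; split=> [s sn||]; rewrite dot_uvecD !dot_uvecZ.
  - have := m1 s sn; have := q1 s sn; nra.
  - nra.
  - nra.
have [xm|mx] := leP x m.1.
  have am : 0 < m.1 - a1 by rewrite subr_gt0 (lt_le_trans ax).
  have [|p Hp Ep] := key left_end ((x - a1) / (m.1 - a1)) body_left_end.
    apply/andP; split; first by rewrite divr_gt0// subr_gt0.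
    by rewrite ler_pdivrMr// mul1r lerB.
  exists p => //; rewrite Ep; move: (a1) am => a am.
  by field; rewrite gt_eqF.
have bm : 0 < b1 - m.1 by rewrite subr_gt0 (lt_trans mx).
have [|p Hp Ep] := key right_end ((b1 - x) / (b1 - m.1)) body_right_end.
  apply/andP; split; first by rewrite divr_gt0// subr_gt0.
  by rewrite ler_pdivrMr// mul1r lerB// ltW.
exists p => //; rewrite Ep; move: (b1) bm => b bm.
by field; rewrite gt_eqF.
Qed.

(** With b = h(0), h(t) <= b cos t + sin t < b cos t + 1, so the quadrant of
    angle t meets the horizontal line strictly to the left of the right end. The
    margin is uniform and survives small perturbations. *)
Lemma right_walls : exists2 mu, 0 < mu & forall x t, b1 <= x -> t \in th ->
  wall c t x <= - mu.
Proof.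
have [mu mu0 muH] : exists2 k, 0 < k & forall t, t \in th -> k <= - wall c t b1.
  apply: seq_lower_bound => t tth; rewrite oppr_gt0 /wall.
  have st := sin_theta om thP tth; have ct := cos_theta om thP tth.
  rewrite -(@line_lt_dot _ _ _ (b1, 0))// dot_uvec mul0r addr0.
  have [H _ _] := cP; have [p bp <-] := H _ (theta_normal omega tth).
  rewrite dot_uvec [(_, _).1]/=.
  have := right_end_max bp; have [/(_ _ (pihalf_normal omega th))+ _ _] := bp.
  rewrite dot_up c2 => p2 p1.
  have s1 : sin t < 1 by have := cos2Dsin2 t; nra.
  have h1 : p.1 * cos t <= b1 * cos t by rewrite ler_pM2r.
  have h2 : p.2 * sin t <= 1 * sin t by rewrite ler_pM2r.
  by move: h1 h2; rewrite /=; lra.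
exists mu => // x t bx tth; have := muH t tth; rewrite lerNr; apply: le_trans.
have st := sin_theta om thP tth; have ct := cos_theta om thP tth.
by rewrite /wall /line ler_pM2r ?invr_gt0// lerD2l lerN2 ler_pM2r.
Qed.

(** The mirror image of [right_walls], in the frame (u_omega, v_omega). *)
Lemma left_walls : exists2 mu, 0 < mu & forall x t, x <= a1 -> t \in th ->
  wall c (t + pi / 2) x <= wall c omega x - mu.
Proof.
have sw := sin_omega om thP; have cw := cos_omega om.
have [mu mu0 muH] : exists2 k, 0 < k & forall t, t \in th ->
    k <= wall c omega a1 - wall c (t + pi / 2) a1.
  apply: seq_lower_bound => t tth; rewrite subr_gt0.
  have st := sin_theta om thP tth; have ct := cos_theta om thP tth.
  have <- : left_end.2 = wall c omega a1.
    by apply/dot_eq_line => //; rewrite left_end_ground c1 subrr.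
  rewrite /wall -line_lt_dot; last by rewrite sinDpihalf.
  have tn := theta_pihalf_normal omega tth.
  have [H _ _] := cP; have [p bp <-] := H _ tn.
  rewrite [X in X - 1]dot_frame [ltRHS]dot_frame.
  rewrite left_end_ground left_end_v mul0r add0r.
  have := left_end_max bp; have [/(_ _ (omega_normal omega th))+ p0 _] := bp.
  rewrite c1 subrr in p0; rewrite c1.
  have -> : t + pi / 2 - omega = t - omega + pi / 2 by ring.
  rewrite cosDpihalf sinDpihalf -sinN opprB -[cos _]cosN opprB.
  have /andP[t0 t1] := thP tth; have pi0 := @pi_gt0 R; case/andP: om => o1 o2.
  have s0 : 0 < sin (omega - t) by apply: sin_gt0_pi; apply/andP; split; lra.
  have d0 : 0 < cos (omega - t) by apply: cos_gt0_pihalf; apply/andP; split; lra.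
  have s1 : sin (omega - t) < 1 by have := cos2Dsin2 (omega - t); nra.
  nra.
exists mu => // x t xa tth; have := muH t tth.
have st := sin_theta om thP tth; have ct := cos_theta om thP tth.
suff : wall c (t + pi / 2) x - wall c omega x <= wall c (t + pi / 2) a1 - wall c omega a1 by lra.
have E d s y : line d s y = line d s 0 - y * (cos s / sin s) by rewrite /line; ring.
rewrite /wall [line _ _ x]E [line (_ omega - _) _ x]E [line _ _ a1]E [line (_ omega - _) _ a1]E.
rewrite cosDpihalf sinDpihalf.
have h1 : 0 <= sin t / cos t by rewrite divr_ge0 ?ltW.
have h2 : 0 <= cos omega / sin omega by rewrite divr_ge0// ltW.
rewrite mulNr; move: h1 h2; set X := sin t / _; set Y := cos omega / _ => h1 h2.
have : x * (X + Y) <= a1 * (X + Y) by rewrite ler_wpM2r// addr_ge0.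
lra.
Qed.

End Ends.

(** * One-dimensional measure *)

Section MeasureLemmas.
Context {R : realType}.
Local Notation lambda := (@lebesgue_measure R).
Implicit Types (f g : R -> R) (a b : R).

Lemma measurable_le_set f g : continuous f -> continuous g ->
  measurable [set x | f x <= g x].
Proof.
move=> cf cg; apply: closed_measurable.
rewrite (_ : [set x | f x <= g x] = (fun x => f x - g x) @^-1` [set y | y <= 0]).
  apply: closed_comp; last exact: closed_le.
  by move=> x _; apply: cvgB; [exact: cf|exact: cg].
by apply/seteqP; split=> x /=; rewrite subr_le0.
Qed.

Lemma measurable_lt_set f g : continuous f -> continuous g ->
  measurable [set x | f x < g x].
Proof.
move=> cf cg; rewrite (_ : [set x | f x < g x] = ~` [set x | g x <= f x]).
  by apply: measurableC; exact: measurable_le_set.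
by apply/seteqP; split=> x /=; rewrite ltNge => /negP.
Qed.

Lemma measurable_eq_set f g : continuous f -> continuous g ->
  measurable [set x | f x = g x].
Proof.
move=> cf cg.
rewrite (_ : [set x | f x = g x] = [set x | f x <= g x] `&` [set x | g x <= f x]).
  by apply: measurableI; apply: measurable_le_set.
apply/seteqP; split=> x /=; first by move=> ->; rewrite lexx.
by case=> h1 h2; apply/eqP; rewrite eq_le h1 h2.
Qed.

Lemma lebesgue_measure_segment a b : a <= b -> lambda `[a, b]%classic = (b - a)%:E.
Proof.
by rewrite lebesgue_measure_itv/= lte_fin le_eqVlt => /predU1P[->|->//]; rewrite ltxx subrr.
Qed.

Lemma integral_compact_support_lt f a b : a <= b -> continuous f ->
  (forall x, 0 <= f x) -> (forall x, ~~ (a <= x <= b) -> f x = 0) ->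
  (\int[lambda]_x (f x)%:E < +oo)%E.
Proof.
move=> ab cf f0 fout.
have [z _ zM] := EVT_max ab (continuous_subspaceT cf).
have mI : measurable (`[a, b]%classic : set R) by exact: measurable_itv.
apply: (@le_lt_trans _ _ (\int[lambda]_x ((f z)%:E * (\1_(`[a, b]%classic) x)%:E))%E).
  apply: ge0_le_integral => //.
  - by move=> x _; rewrite lee_fin.
  - by apply/measurable_EFinP; exact: continuous_measurable_fun.
  - apply/measurable_EFinP/measurable_funM => //.
  - move=> x _; rewrite -EFinM lee_fin indicE.
    have [xI|xI] := boolP (a <= x <= b).
      by rewrite mem_set ?mulr1 ?zM//= in_itv.
    by rewrite (fout _ xI) mulr_ge0.
rewrite ge0_integralZl_EFin//; last by apply/measurable_EFinP; exact: measurable_indic.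
rewrite integral_indic// setIT.
by have /= -> := lebesgue_measure_segment ab; rewrite -EFinM ltry.
Qed.

Lemma integral_EFinD (f g : R -> R) : measurable_fun [set: R] f -> measurable_fun [set: R] g ->
  (forall x, 0 <= f x) -> (forall x, 0 <= g x) ->
  (\int[lambda]_x (f x + g x)%:E = \int[lambda]_x (f x)%:E + \int[lambda]_x (g x)%:E)%E.
Proof.
move=> mf mg f0 g0; under eq_integral do rewrite EFinD.
apply: ge0_integralD => //; try exact/measurable_EFinP.
  by move=> x _; rewrite lee_fin.
by move=> x _; rewrite lee_fin.
Qed.

(** Gains and losses that are constant on a set of abscissas are integrated in
    this form. *)
Lemma integral_scaled_indic (k : R) (A : set R) : 0 <= k -> measurable A ->
  (\int[lambda]_x (k * \1_A x)%:E = k%:E * lambda A)%E.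
Proof.
move=> k0 mA; under eq_integral do rewrite EFinM.
rewrite ge0_integralZl_EFin//; last by apply/measurable_EFinP; exact: measurable_indic.
by rewrite integral_indic// setIT.
Qed.

Lemma measurable_scaled_indic (k : R) (A : set R) : measurable A ->
  measurable_fun [set: R] (fun x => k * \1_A x).
Proof. by move=> mA; apply: measurable_funM => //; exact: measurable_indic. Qed.

End MeasureLemmas.

(** * First variation, one abscissa at a time *)

Section Pointwise.
Context {R : realType} (omega : R) (th : seq R).
Context (om : 0 < omega <= pi / 2) (thP : forall t, t \in th -> 0 < t < omega).
Context (th0 : th != [::]).
Local Notation roof := (roof omega th).
Local Notation ground := (ground omega).
Local Notation crest := (crest omega th).
Local Notation body := (body omega th).
Local Notation normals := (normals omega th).
Local Notation cap_profile := (cap_profile omega th).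
Local Notation thickness := (thickness omega th).
Implicit Types (v p : R * R) (x y s t e : R).
Context (c : R -> R) (cP : cap_profile c) (c1 : c omega = 1) (c2 : c (pi / 2) = 1).
Local Notation a1 := (left_end omega th c).1.
Local Notation b1 := (right_end omega th c).1.

(** Abscissas at which lowering the side of normal u_t by e removes points of
    the cap. *)
Definition near_edge t e : set R :=
  [set x | a1 <= x <= b1 /\ line (c t) t x - e < roof c x].

(** Abscissas at which the whole vertical section of the cap might be removed;
    only a crude bound is available there, but this set shrinks to the two ends
    of the cap. *)
Definition thin_part e : set R :=
  [set x | a1 <= x <= b1 /\ roof c x - e < ground c x].

(** Abscissas at which the crest follows the wall of normal u_t and stays
    farther than e from all other walls, so that lowering this wall by e lowers
    the crest by e. *)
Definition core_edge t e : set R :=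
  [set x | [/\ a1 <= x <= b1, crest c x = wall c t x &
    forall s, s \in normals -> s != t -> e < `|wall c s x - wall c t x|]].

(** The strict margins of [right_walls] and [left_walls] absorb the recession of
    the lower sides, so the perturbed niche has no points beyond the ends of the
    cap. *)
Lemma crest_off d mu : (forall s, s \in normals -> d s <= c s) ->
  d omega >= c omega - mu * sin omega -> d (pi / 2) >= c (pi / 2) - mu ->
  (forall x t, b1 <= x -> t \in th -> wall c t x <= - mu) ->
  (forall x t, x <= a1 -> t \in th -> wall c (t + pi / 2) x <= wall c omega x - mu) ->
  forall x, ~~ (a1 < x < b1) -> crest d x = ground d x.
Proof.
move=> dc dw dh Hr Hl x xout.
have W s y : s \in normals -> wall d s y <= wall c s y.
  by move=> sn; rewrite /wall ler_line ?lerB ?dc//; exact: sin_normals sn.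
apply/eqP; rewrite eq_le ground_le_crest andbT; apply/crest_le; split=> // t tth.
have [xa|ax] := leP x a1.
  right; apply: le_trans (W _ _ (theta_pihalf_normal omega tth)) _.
  apply: le_trans (Hl _ _ xa tth) _.
  rewrite groundE le_max; apply/orP; left.
  have sw := sin_omega om thP.
  have -> : wall c omega x - mu = line (c omega - 1 - mu * sin omega) omega x.
    by rewrite line_shift mulfK// gt_eqF.
  by rewrite ler_line//; lra.
left; apply: le_trans (W _ _ (theta_normal omega tth)) _.
have bx : b1 <= x by move: xout; rewrite ax /= -leNgt.
apply: le_trans (Hr _ _ bx tth) _.
rewrite groundE le_max; apply/orP; right.
by rewrite wall_up; move: dh; rewrite c2; lra.
Qed.

(** Each wall not above the crest ends up at least eta below the old crest: the
    moved wall by construction, the others because they were already that far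
    below. *)
Lemma crest_drop d t eta x : t \in normals ->
  (forall s, s \in normals -> d s <= c s) -> d t <= c t - eta * sin t ->
  core_edge t eta x -> crest d x <= crest c x - eta.
Proof.
move=> tn dc dt [_ Ex Hs].
have W s : s \in normals -> wall d s x <= wall c s x.
  by move=> sn; rewrite /wall ler_line ?lerB ?dc//; exact: sin_normals sn.
have Wt : wall d t x <= wall c t x - eta.
  have st := sin_normals om thP tn.
  have -> : wall c t x - eta = line (c t - 1 - eta * sin t) t x.
    by rewrite line_shift mulfK// gt_eqF.
  by rewrite ler_line//; lra.
have key s : s \in normals -> wall c s x <= crest c x -> wall d s x <= crest c x - eta.
  rewrite Ex => sn H; have [->//|nst] := eqVneq s t.
  have := Hs s sn nst; rewrite distrC ger0_norm ?subr_ge0// => h.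
  by have := W s sn; lra.
have /crest_le[] := lexx (crest c x); rewrite ground_le => /andP[h1 h2] h3.
apply/crest_le; split.
  by rewrite ground_le !key ?omega_normal ?pihalf_normal.
move=> u uth; case: (h3 u uth) => h; [left|right]; apply: key => //.
  exact: theta_normal.
exact: theta_pihalf_normal.
Qed.

(** The first variation of the sofa area at a fixed abscissa. Where the cut
    leaves some of the section, the cap loses at most eta on [near_edge] and the
    niche loses at least eta on [core_edge]; the recession of the ground adds
    the same length to the sections of the cap and of the niche and cancels. On
    [thin_part] all changes are O(eta). *)
Lemma thickness_exchange d t eta C x : t \in normals -> 0 < eta ->
  (forall s, s \in normals -> d s <= c s) -> d t <= c t - eta * sin t ->
  d omega >= c omega - C * eta * sin omega -> d (pi / 2) >= c (pi / 2) - C * eta ->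
  (forall p, body c p -> dot p (uvec t) <= c t - eta * sin t ->
    forall s, s \in normals -> dot p (uvec s) <= d s) ->
  (forall x, ~~ (a1 < x < b1) -> crest d x = ground d x) ->
  thickness c x + (crest d x - ground d x) + eta * \1_(core_edge t eta) x <=
  thickness d x + (crest c x - ground c x) + eta * \1_(near_edge t eta) x
    + (C + 2) * eta * \1_(thin_part eta) x.
Proof.
move=> tn eta0 dc dt dw dh dcut doff.
have st := sin_normals om thP tn; have sw := sin_omega om thP.
have C0 : 0 <= C.
  by have := dc _ (pihalf_normal omega th); rewrite -(pmulr_lge0 _ eta0); lra.
have W s y : s \in normals -> wall d s y <= wall c s y.
  by move=> sn; rewrite /wall ler_line ?lerB ?dc//; exact: sin_normals sn.
have fc := ground_le_crest omega th c x.
have g1 : ground d x <= ground c x.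
  by rewrite ground_le groundE !le_max !W ?omega_normal ?pihalf_normal ?orbT.
have g2 : ground c x - C * eta <= ground d x.
  rewrite lerBlDr ground_le; apply/andP; split.
    apply: (@le_trans _ _ (wall d omega x + C * eta)).
      rewrite -lerBlDr.
      have -> : wall c omega x - C * eta = line (c omega - 1 - C * eta * sin omega) omega x.
        by rewrite line_shift mulfK// gt_eqF.
      by rewrite ler_line//; lra.
    by rewrite lerD2r groundE le_max lexx.
  apply: (@le_trans _ _ (wall d (pi / 2) x + C * eta)).
    by rewrite !wall_up; lra.
  by rewrite lerD2r groundE le_max lexx orbT.
have td := thickness_ge0 omega th d x.
have [xin|xout] := boolP (a1 <= x <= b1); last first.
  have -> : thickness c x = 0.
    rewrite thicknessE max_l// subr_le0 ltW// ltNge.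
    by rewrite (ground_le_roof om thP th0 cP c1 c2).
  rewrite doff; last first.
    by apply: contra xout => /andP[/ltW -> /ltW ->].
  rewrite !indicE !memNset; last 3 first.
  - by move=> [h _]; rewrite h in xout.
  - by move=> [h _]; rewrite h in xout.
  - by move=> [h _ _]; rewrite h in xout.
  by rewrite subrr !mulr0 !addr0; lra.
have gr : ground c x <= roof c x by rewrite (ground_le_roof om thP th0 cP c1 c2).
have -> : thickness c x = roof c x - ground c x.
  by rewrite thicknessE max_r// subr_ge0.
have H1 : crest d x + eta * \1_(core_edge t eta) x <= crest c x.
  rewrite indicE; have [/set_mem xc|xc] := boolP (x \in core_edge t eta).
    by rewrite mulr1 -lerBrDr; exact: (crest_drop tn dc dt xc).
  rewrite mulr0 addr0; have /crest_le[] := lexx (crest c x); rewrite ground_le => /andP[h1 h2] h3.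
  apply/crest_le; split; first by exact: le_trans fc.
  move=> u uth; case: (h3 u uth) => h; [left|right]; apply: le_trans h; apply: W.
    exact: theta_normal.
  exact: theta_pihalf_normal.
have Lr : roof c x <= line (c t) t x by have /le_roof/(_ t tn) := lexx (roof c x).
rewrite [\1_(thin_part eta) x]indicE.
have [/set_mem[_ xt]|xt] := boolP (x \in thin_part eta).
  have : 0 <= eta * \1_(near_edge t eta) x by rewrite mulr_ge0// ltW.
  by rewrite mulr1; nra.
have {}xt : ground c x <= roof c x - eta.
  by rewrite leNgt; apply: contra xt => xt; apply/mem_set.
rewrite mulr0 addr0.
(* The highest point above x that survives the cut. *)
pose y := Order.min (roof c x) (line (c t) t x - eta).
have by_ : body c (x, y).
  by apply/(bodyP om thP); rewrite /= ge_min lexx /= le_min gr /=; lra.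
have yd : y <= roof d x.
  apply/le_roof => s sn; rewrite -(@dot_le_line _ _ _ (x, y)); last exact: sin_normals sn.
  apply: dcut => //; rewrite dot_le_line//= line_shift mulfK ?gt_eqF//.
  by rewrite /y ge_min lexx orbT.
have T : y - ground d x <= thickness d x.
  by rewrite thicknessE le_max; apply/orP; right; rewrite lerB.
have Y : roof c x - eta * \1_(near_edge t eta) x <= y.
  rewrite indicE; have [/set_mem[_ xc]|xc] := boolP (x \in near_edge t eta).
    by rewrite mulr1 le_min; apply/andP; split; lra.
  rewrite mulr0 subr0 le_min lexx /= leNgt; apply: contra xc => xc; exact/mem_set.
lra.
Qed.

End Pointwise.

(** * Comparing a side of a maximum cap with the niche *)

Section EdgeInequality.
Context {R : realType} (omega : R) (th : seq R).
Context (om : 0 < omega <= pi / 2) (thP : forall t, t \in th -> 0 < t < omega).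
Context (th0 : th != [::]).
Local Notation lambda := (@lebesgue_measure R).
Local Notation roof := (roof omega th).
Local Notation ground := (ground omega).
Local Notation crest := (crest omega th).
Local Notation body := (body omega th).
Local Notation hole := (hole omega th).
Local Notation normals := (normals omega th).
Local Notation cap_profile := (cap_profile omega th).
Local Notation thickness := (thickness omega th).
Implicit Types (v p : R * R) (x y s t e : R).
Context (c : R -> R) (cP : cap_profile c) (c1 : c omega = 1) (c2 : c (pi / 2) = 1).
Local Notation a1 := (left_end omega th c).1.
Local Notation b1 := (right_end omega th c).1.
Local Notation core_edge := (core_edge omega th c).
Local Notation near_edge := (near_edge omega th c).
Local Notation thin_part := (thin_part omega th c).
Local Notation I := (`[a1, b1]%classic : set R).

Lemma continuous_wall d s : continuous (wall d s).
Proof. by rewrite /wall; exact: continuous_line. Qed.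

Lemma measurable_near_edge t e : measurable (near_edge t e).
Proof.
rewrite (_ : near_edge t e = I `&` [set x | line (c t) t x - e < roof c x]).
  apply: measurableI; first exact: measurable_itv.
  apply: measurable_lt_set; last exact: continuous_roof.
  by move=> x; apply: cvgB; [exact: continuous_line|exact: cvg_cst].
by apply/seteqP; split=> x; rewrite /= in_itv.
Qed.

Lemma measurable_thin_part e : measurable (thin_part e).
Proof.
rewrite (_ : thin_part e = I `&` [set x | roof c x - e < ground c x]).
  apply: measurableI; first exact: measurable_itv.
  apply: measurable_lt_set; last exact: continuous_ground.
  by move=> x; apply: cvgB; [exact: continuous_roof|exact: cvg_cst].
by apply/seteqP; split=> x; rewrite /= in_itv.
Qed.

Lemma measurable_core_edge t e : measurable (core_edge t e).
Proof.
rewrite (_ : core_edge t e = I `&` [set x | crest c x = wall c t x] `&`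
    \bigcap_(s in [set` [seq s <- normals | s != t]])
      [set x | e < `|wall c s x - wall c t x|]).
  apply: measurableI; first apply: measurableI; first exact: measurable_itv.
    by apply: measurable_eq_set; [exact: continuous_crest|exact: continuous_wall].
  apply: fin_bigcap_measurable; first exact: finite_seq.
  move=> s _; apply: measurable_lt_set => x; first exact: cvg_cst.
  by apply: cvg_norm; apply: cvgB; exact: continuous_wall.
apply/seteqP; split=> x.
  case=> xI Ex Hs; split; first by split => //; rewrite /= in_itv.
  by move=> s /=; rewrite mem_filter => /andP[nst sn]; exact: Hs.
case=> -[]; rewrite /= in_itv /= => xI Ex Hs; split=> // s sn nst.
by apply: Hs; rewrite /= mem_filter nst.
Qed.

Lemma area_body_lt : (area (body c) < +oo)%E.
Proof.
rewrite area_body//; apply: (integral_compact_support_lt (ends_le om thP th0 cP c1 c2)).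
- move=> x; apply: (@continuous_max R R (fun=> 0) (fun x => roof c x - ground c x)).
    exact: cvg_cst.
  by apply: cvgB; [exact: continuous_roof|exact: continuous_ground].
- by move=> x; exact: thickness_ge0.
- move=> x xout; rewrite thicknessE max_l// subr_le0 ltW// ltNge.
  by rewrite (ground_le_roof om thP th0 cP c1 c2).
Qed.

Lemma area_hole_lt d : (forall x, ~~ (a1 < x < b1) -> crest d x = ground d x) ->
  (area (hole d) < +oo)%E.
Proof.
move=> H; rewrite area_hole//.
apply: (integral_compact_support_lt (ends_le om thP th0 cP c1 c2)).
- by move=> x; apply: cvgB; [exact: continuous_crest|exact: continuous_ground].
- by move=> x; rewrite subr_ge0 ground_le_crest.
- move=> x xout; rewrite H ?subrr//; apply: contra xout => /andP[/ltW -> /ltW ->] //.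
Qed.

Lemma crest_off_ends x : ~~ (a1 < x < b1) -> crest c x = ground c x.
Proof.
have [mu mu0 muH] := right_walls om thP th0 cP c2.
have [nu nu0 nuH] := left_walls om thP th0 cP c1.
apply: (crest_off om thP c2 (mu := Order.min mu nu)) => //.
- by rewrite lerBlDr lerDl mulr_ge0 ?le_min ?(ltW mu0) ?(ltW nu0)// ltW// (sin_omega om thP).
- by rewrite lerBlDr lerDl le_min ?(ltW mu0) ?(ltW nu0).
- by move=> y t h1 h2; apply: le_trans (muH _ _ h1 h2) _; rewrite lerN2 ge_min lexx.
- by move=> y t h1 h2; apply: le_trans (nuH _ _ h1 h2) _; rewrite lerB// ge_min lexx orbT.
Qed.

Context (cmax : forall d, cap_profile d -> d omega <= 1 -> d (pi / 2) <= 1 ->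
  (area (hole d) < +oo)%E ->
  (area (body d) + area (hole c) <= area (body c) + area (hole d))%E).

(** Integrate [thickness_exchange] and compare with the maximality of the area:
    what the niche loses is at most what the cap loses. *)
Lemma edge_inequality_approx t : t \in normals -> exists C e0, [/\ 0 <= C, 0 < e0 &
  forall e, 0 < e < e0 ->
  (lambda (core_edge t e) <= lambda (near_edge t e) + C%:E * lambda (thin_part e))%E].
Proof.
move=> tn; have st := sin_normals om thP tn; have st1 := sin_le1 t.
have sw := sin_omega om thP; have sw1 := sin_le1 omega.
have [mu mu0 muH] := right_walls om thP th0 cP c2.
have [nu nu0 nuH] := left_walls om thP th0 cP c1.
have [C1 [e0 [C10 e00 cut]]] := cut_profile om thP th0 cP c1 c2 tn.
(* e is measured vertically: a shift of a side of normal u_s by x moves it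
   vertically by x / sin s. So the side of angle t is cut by e * sin t, and the
   lower sides recede vertically by at most C * e. *)
pose C := C1 / sin omega; have C0 : 0 < C by exact: divr_gt0.
pose m := Order.min mu nu; have m0 : 0 < m by rewrite lt_min mu0.
exists (C + 2), (Order.min e0 (m / C)); split.
- by lra.
- by rewrite lt_min e00 divr_gt0.
move=> e /andP[ep]; rewrite lt_min ltr_pdivlMr// => /andP[ee0 emu].
have [|d [dP dc dt dcut]] := cut (e * sin t).
  by rewrite mulr_gt0//= (le_lt_trans _ ee0)// ger_pMr.
have dle s : s \in normals -> d s <= c s by move=> /dc/andP[].
have ow := omega_normal omega th; have ph := pihalf_normal omega th.
have Cs : C * sin omega = C1 by rewrite divfK ?gt_eqF.
have CC : C1 <= C by rewrite ler_pdivlMr//; nra.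
have dw : d omega >= c omega - C * e * sin omega.
  have /andP[h _] := dc _ ow; apply: le_trans h; rewrite lerD2l lerN2.
  by rewrite mulrAC Cs ler_pM2l//; nra.
have dh : d (pi / 2) >= c (pi / 2) - C * e.
  have /andP[h _] := dc _ ph; apply: le_trans h; rewrite lerD2l lerN2.
  apply: (@le_trans _ _ (C1 * e)); last by rewrite ler_pM2r.
  by rewrite ler_pM2l// ger_pMr.
have doff : forall x, ~~ (a1 < x < b1) -> crest d x = ground d x.
  apply: (crest_off om thP c2 (mu := m)) => //.
  - apply: le_trans dw; rewrite lerD2l lerN2 ler_pM2r//; lra.
  - apply: le_trans dh; rewrite lerD2l lerN2; lra.
  - by move=> y u h1 h2; apply: le_trans (muH _ _ h1 h2) _; rewrite lerN2 ge_min lexx.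
  - by move=> y u h1 h2; apply: le_trans (nuH _ _ h1 h2) _; rewrite lerB// ge_min lexx orbT.
have hd := area_hole_lt doff; have hc := area_hole_lt crest_off_ends.
have bc := area_body_lt.
have M : (area (body d) + area (hole c) <= area (body c) + area (hole d))%E.
  by apply: cmax => //; [have := dle _ ow; rewrite c1|have := dle _ ph; rewrite c2].
have mth u : measurable_fun [set: R] (thickness u).
  by apply/measurable_EFinP; exact: measurable_thickness.
have mcr u : measurable_fun [set: R] (fun x => crest u x - ground u x).
  by apply/measurable_EFinP; exact: measurable_crestB.
have cr0 u x : 0 <= crest u x - ground u x by rewrite subr_ge0 ground_le_crest.
have ind0 k (A : set R) x : 0 <= k -> 0 <= k * \1_A x :> R.
  by move=> k0; rewrite mulr_ge0.
have mD := measurable_core_edge t e; have mE := measurable_near_edge t e.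
have mW := measurable_thin_part e.
have mDi := measurable_scaled_indic e mD; have mEi := measurable_scaled_indic e mE.
have mWi := measurable_scaled_indic ((C + 2) * e) mW.
have Ce0 : 0 <= (C + 2) * e by rewrite mulr_ge0; lra.
have e0' := ltW ep.
have th_0 := thickness_ge0 omega th.
have : (area (body c) + area (hole d) + e%:E * lambda (core_edge t e) <=
    area (body d) + area (hole c) + e%:E * lambda (near_edge t e)
    + ((C + 2) * e)%:E * lambda (thin_part e))%E.
  rewrite !area_body// !area_hole// -!integral_scaled_indic//.
  have mA u w : measurable_fun [set: R]
      (fun x => thickness u x + (crest w x - ground w x)) by exact: measurable_funD.
  have A0 u w x : 0 <= thickness u x + (crest w x - ground w x) by rewrite addr_ge0.
  have AI0 u w A k x : 0 <= k ->
      0 <= thickness u x + (crest w x - ground w x) + k * \1_A x.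
    by move=> k0; rewrite addr_ge0// ind0.
  rewrite -!integral_EFinD//; try (by move=> x; rewrite ?AI0 ?ind0).
    2: by apply: measurable_funD; [exact: mA|exact: mEi].
  apply: ge0_le_integral => //.
  - by move=> x _; rewrite lee_fin addr_ge0// ind0.
  - by apply/measurable_EFinP; apply: measurable_funD; [exact: mA|exact: mDi].
  - apply/measurable_EFinP; apply: measurable_funD; last exact: mWi.
    by apply: measurable_funD; [exact: mA|exact: mEi].
  - by move=> x _; rewrite lee_fin; exact: thickness_exchange.
have fX : (area (body c) + area (hole d))%E \is a fin_num.
  rewrite ge0_fin_numE; first exact: lte_add_pinfty.
  apply: adde_ge0; rewrite ?area_body ?area_hole//; apply: integral_ge0 => x _;
    by rewrite lee_fin.
move=> H; have : (area (body c) + area (hole d) + e%:E * lambda (core_edge t e) <=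
    area (body c) + area (hole d) + (e%:E * lambda (near_edge t e)
    + ((C + 2) * e)%:E * lambda (thin_part e)))%E.
  by apply: le_trans H _; rewrite -addeA leeD2r.
rewrite leeD2lE// [((C + 2) * e)%R]mulrC EFinM -muleA -ge0_muleDr ?mule_ge0 ?lee_fin//; last lra.
by rewrite lee_pmul2l// lte_fin.
Qed.
(** The limit of [core_edge]: the part of the crest on the wall of normal u_t,
    without the finitely many points where walls cross. *)
Definition edge_core t : set R :=
  [set x | [/\ a1 <= x <= b1, crest c x = wall c t x &
    forall s, s \in normals -> s != t -> wall c s x != wall c t x]].

Definition full_edge t : set R :=
  [set x | a1 <= x <= b1 /\ roof c x = line (c t) t x].

Lemma edge_core_bigcup t (e : nat -> R) : (forall n, 0 < e n) ->
  (forall d, 0 < d -> exists n, e n < d) ->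
  \bigcup_n core_edge t (e n) = edge_core t.
Proof.
move=> e0 esmall; apply/seteqP; split=> x.
  case=> n _ [xI Ex Hs]; split=> // s sn nst.
  by rewrite -subr_eq0 -normr_gt0 (lt_trans (e0 n))// Hs.
case=> xI Ex Hs.
have [k k0 kH] : exists2 k, 0 < k & forall s, s \in [seq s <- normals | s != t] ->
    k <= `|wall c s x - wall c t x|.
  apply: seq_lower_bound => s; rewrite mem_filter => /andP[nst sn].
  by rewrite normr_gt0 subr_eq0 Hs.
have [n nk] := esmall k k0; exists n => //; split=> // s sn nst.
by rewrite (lt_le_trans nk)// kH// mem_filter nst.
Qed.

Lemma near_edge_bigcap t (e : nat -> R) : t \in normals -> (forall n, 0 < e n) ->
  (forall d, 0 < d -> exists n, e n < d) ->
  \bigcap_n near_edge t (e n) = full_edge t.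
Proof.
move=> tn e0 esmall; apply/seteqP; split=> x; last first.
  by case=> xI Ex n _; split=> //; rewrite Ex ltrBlDr ltrDl.
move=> H; have [xI _] := H 0%N Logic.I; split=> //.
apply/eqP; rewrite eq_le; apply/andP; split.
  by have /le_roof/(_ t tn) := lexx (roof c x).
rewrite leNgt; apply/negP; rewrite -subr_gt0 => /esmall[n].
by have [_] := H n Logic.I; lra.
Qed.

Lemma thin_part_bigcap (e : nat -> R) : (forall d, 0 < d -> exists n, e n < d) ->
  \bigcap_n thin_part (e n) `<=` [set a1; b1].
Proof.
move=> esmall x H; have [/andP[ax xb] _] := H 0%N Logic.I.
have [xab|] := boolP (a1 < x < b1).
  have := ground_lt_roof om thP th0 cP c1 c2 xab; rewrite -subr_gt0 => /esmall[n].
  by have [_] := H n Logic.I; lra.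
rewrite negb_and -!leNgt => /orP[xa|bx]; [left|right]; apply/eqP; rewrite eq_le.
  by rewrite ax xa.
by rewrite xb bx.
Qed.

(** Let e tend to 0 in [edge_inequality_approx]; the sets of abscissas are
    monotone in e, and [thin_part] shrinks to a set of at most two points. *)
Lemma core_le_full_edge t : t \in normals ->
  (lambda (edge_core t) <= lambda (full_edge t))%E.
Proof.
move=> tn; have [C [e0 [C0 e00 H]]] := edge_inequality_approx tn.
(* n + 2 keeps all terms strictly below e0. *)
pose e n := e0 / n.+2%:R.
have ep n : 0 < e n by rewrite divr_gt0.
have ee0 n : e n < e0 by rewrite ltr_pdivrMr// ltr_pMr// ltr1n.
have esmall d : 0 < d -> exists n, e n < d.
  move=> d0; have [n] := ltr_add_invr (divr_gt0 d0 e00); rewrite add0r => nd.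
  exists n; have : n.+2%:R^-1 < d / e0.
    by apply: le_lt_trans nd; rewrite lef_pV2 ?posrE// ler_nat.
  by rewrite ltr_pdivlMr// mulrC.
have edec m n : (m <= n)%N -> e n <= e m.
  by move=> mn; rewrite ler_pM2l// lef_pV2 ?posrE// ler_nat ltnS.
have mI (A : set R) : A `<=` I -> measurable A -> (lambda A < +oo)%E.
  move=> AI mA; apply: le_lt_trans (ltry (b1 - a1)).
  rewrite -(lebesgue_measure_segment (ends_le om thP th0 cP c1 c2)).
  by apply: le_measure => //; rewrite inE//; exact: measurable_itv.
have cD : lambda (core_edge t (e n)) @[n --> \oo] --> lambda (edge_core t).
  rewrite -(edge_core_bigcup t ep esmall); apply: nondecreasing_cvg_mu.
  - by move=> n; exact: measurable_core_edge.
  - by apply: bigcup_measurable => n _; exact: measurable_core_edge.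
  - move=> m n mn; apply/subsetPset => x [xI Ex Hs]; split=> // s sn nst.
    by apply: le_lt_trans (Hs s sn nst); exact: edec.
have cE : lambda (near_edge t (e n)) @[n --> \oo] --> lambda (full_edge t).
  rewrite -(near_edge_bigcap tn ep esmall); apply: nonincreasing_cvg_mu.
  - apply: mI; last exact: measurable_near_edge.
    by move=> x [xI _]; rewrite /= in_itv.
  - by move=> n; exact: measurable_near_edge.
  - by apply: bigcapT_measurable => n; exact: measurable_near_edge.
  - move=> m n mn; apply/subsetPset => x [xI Hx]; split=> //.
    by have := edec _ _ mn; lra.
have cW : lambda (thin_part (e n)) @[n --> \oo] --> 0%E.
  have W0 : lambda (\bigcap_n thin_part (e n)) = 0%E.
    apply: countable_lebesgue_measure0; apply: finite_set_countable.
    by apply: sub_finite_set (thin_part_bigcap esmall) _; exact: finite_set2.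
  rewrite -W0; apply: nonincreasing_cvg_mu.
  - apply: mI; last exact: measurable_thin_part.
    by move=> x [xI _]; rewrite /= in_itv.
  - by move=> n; exact: measurable_thin_part.
  - by apply: bigcapT_measurable => n; exact: measurable_thin_part.
  - move=> m n mn; apply/subsetPset => x [xI Hx]; split=> //.
    by have := edec _ _ mn; lra.
have cCW : (C%:E * lambda (thin_part (e n)))%E @[n --> \oo] --> 0%E.
  by rewrite -[X in _ --> X](mule0 C%:E); exact: cvgeZl.
have cEW : (lambda (near_edge t (e n)) + C%:E * lambda (thin_part (e n)))%E @[n --> \oo]
    --> lambda (full_edge t).
  by rewrite -[X in _ --> X]adde0; apply: cvgeD => //; exact: fin_num_adde_defl.
apply: (lee_cvg_to cD cEW); near=> n; apply: H.
by rewrite ep ee0.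
Unshelve. all: by end_near.
Qed.

End EdgeInequality.

(** * Sides of the cap *)

Section FiniteExceptions.
Context {R : realType}.
Local Notation lambda := (@lebesgue_measure R).
Implicit Types (A N : set R) (a b s t : R) (d : R -> R).

Lemma lebesgue_finite N : finite_set N -> lambda N = 0%E.
Proof. by move=> fN; apply: countable_lebesgue_measure0; exact: finite_set_countable. Qed.

Lemma measurable_finite N : finite_set N -> measurable N.
Proof. by move=> fN; apply: countable_measurable => //; exact: finite_set_countable. Qed.

Lemma lebesgue_setD_finite A N : measurable A -> finite_set N ->
  lambda (A `\` N) = lambda A.
Proof.
move=> mA fN; have := measureDI lambda mA (measurable_finite fN).
have /= -> := lebesgue_finite (finite_setIr A fN).
by rewrite adde0.
Qed.

Definition crossings (l : seq R) d : set R :=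
  [set x | exists s s', [/\ s \in l, s' \in l, s != s' & line (d s) s x = line (d s') s' x]].

Lemma finite_crossings l d : (forall s, s \in l -> 0 < s < pi) ->
  finite_set (crossings l d).
Proof.
move=> H; apply: (@sub_finite_set _ _ [set` [seq (d s' * sin s - d s * sin s') / sin (s - s') |
    s <- l, s' <- l]]); last exact: finite_seq.
move=> x [s [s' [sl s'l ss' E]]]; apply/allpairsP; exists (s, s'); split=> //=.
by apply: line_cross => //; exact: H.
Qed.

(** Lengths of sides enter only through their horizontal extents, so that the
    comparison takes place on the line. *)
Lemma sin_euclid_dist t (p q : R * R) : 0 < sin t -> dot (q - p) (uvec t) = 0 ->
  sin t * euclid_dist p q = `|q.1 - p.1|.
Proof.
move=> st; rewrite /euclid_dist dot_uvec /dot /= => E.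
rewrite -{1}(ger0_norm (ltW st)) -sqrtr_sqr -sqrtrM ?sqr_ge0// -sqrtr_sqr.
congr Num.sqrt; rewrite -[RHS]mulr1 -(cos2Dsin2 t).
have -> : (p.1 - q.1) * (p.1 - q.1) + (p.2 - q.2) * (p.2 - q.2) =
  (q.1 - p.1) ^+ 2 + (q.2 - p.2) ^+ 2 by ring.
move: E; set X := q.1 - p.1; set Y := q.2 - p.2 => E.
rewrite mulrDr -exprMn -[sin t ^+ 2 * Y ^+ 2]exprMn.
have -> : sin t * Y = - (X * cos t) by lra.
by rewrite sqrrN; ring.
Qed.

End FiniteExceptions.

Section Faces.
Context {R : realType}.
Implicit Types (K : set (R * R)) (p q : R * R) (s t : R).

Lemma compact_face K t : compact K -> K !=set0 -> compact (face K t) /\ face K t !=set0.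
Proof.
move=> cK K0; have [p Kp Ep] := supp_attained t cK K0; split; last by exists p.
apply: (subclosed_compact _ cK); last by move=> q [].
rewrite (_ : face K t = K `&` (fun p => dot p (uvec t)) @^-1` [set supp K t])//.
apply: closedI; first by apply: compact_closed cK; exact: norm_hausdorff.
apply: closed_comp; [move=> ? _; exact: continuous_dot|exact: closed_eq].
Qed.

Lemma vplusP K t : compact K -> K !=set0 ->
  face K t (vplus K t) /\ forall q, face K t q -> dot q (vvec t) <= dot (vplus K t) (vvec t).
Proof.
move=> cK K0; have [cF F0] := compact_face t cK K0.
have [p Fp Hp] := compact_dot_max (vvec t) cF F0.
by rewrite /vplus; apply: (@getPex _ [set p | face K t p /\ _]); exists p.
Qed.

Lemma dotNr p q : dot p (- q) = - dot p q.
Proof. by rewrite /dot /=; ring. Qed.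

Lemma vminusP K t : compact K -> K !=set0 ->
  face K t (vminus K t) /\ forall q, face K t q -> dot (vminus K t) (vvec t) <= dot q (vvec t).
Proof.
move=> cK K0; have [cF F0] := compact_face t cK K0.
have [p Fp Hp] := compact_dot_max (- vvec t) cF F0.
rewrite /vminus; apply: (@getPex _ [set p | face K t p /\ _]); exists p; split=> // q /Hp.
by rewrite !dotNr lerN2.
Qed.

End Faces.

Section Sigma.
Context {R : realType} (omega : R) (th : seq R).
Context (om : 0 < omega <= pi / 2) (thP : forall t, t \in th -> 0 < t < omega).
Context (th0 : th != [::]).
Local Notation lambda := (@lebesgue_measure R).
Local Notation roof := (roof omega th).
Local Notation body := (body omega th).
Local Notation normals := (normals omega th).
Local Notation cap_profile := (cap_profile omega th).
Implicit Types (v p : R * R) (x y s t e : R).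
Context (c : R -> R) (cP : cap_profile c) (c1 : c omega = 1) (c2 : c (pi / 2) = 1).
Local Notation a1 := (left_end omega th c).1.
Local Notation b1 := (right_end omega th c).1.
Local Notation full_edge := (full_edge omega th c).

Let cB : compact (body c) := compact_body om thP th0.
Let B0 : body c !=set0 := body_nonempty cP.

(** By convexity the roof follows the line of normal u_t exactly between the
    endpoints of the face; v_t points to the left, so [vplus] is the left
    endpoint. *)
Lemma full_edgeE t : t \in normals ->
  full_edge t = `[(vplus (body c) t).1, (vminus (body c) t).1]%classic.
Proof.
move=> tn; have st := sin_normals om thP tn; have sE := supp_body cP tn.
have [[vb Ev] Hv] := vplusP t cB B0; have [[wb Ew] Hw] := vminusP t cB B0.
move: (vplus _ _) (vminus _ _) vb Ev Hv wb Ew Hw => v w vb Ev Hv wb Ew Hw.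
rewrite sE in Ev Ew.
apply/seteqP; split=> x.
  case=> xI Ex.
  have bq : body c (x, roof c x).
    by apply/(bodyP om thP); rewrite /= (ground_le_roof om thP th0 cP c1 c2) xI lexx.
  have fq : face (body c) t (x, roof c x).
    by split=> //; rewrite sE; apply/dot_eq_line.
  have [_ Eq] := fq; rewrite sE in Eq.
  have := Hv _ fq; have := Hw _ fq; have := fst_frame t (x, roof c x).
  rewrite Eq [(x, _).1]/= /= in_itv /=; move: (dot (x, roof c x) (vvec t)) => D -> h1 h2.
  by rewrite (fst_frame t v) (fst_frame t w) Ev Ew !lerD2l !lerN2 !ler_pM2r// h1 h2.
rewrite /= in_itv /= => /andP[vx xw].
have [q bq [Eq qx]] : exists2 q, body c q & dot q (uvec t) = c t /\ q.1 = x.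
  have [vw|vw] := eqVneq v.1 w.1.
    by exists v => //; split=> //; apply/eqP; rewrite eq_le vx vw xw.
  have vw' : 0 < w.1 - v.1 by rewrite subr_gt0 lt_neqAle vw (le_trans vx).
  pose r := (w.1 - x) / (w.1 - v.1).
  exists (r *: v + (1 - r) *: w).
    apply: convex_body_comb vb wb.
    by rewrite divr_ge0 ?(ltW vw') ?subr_ge0//= ler_pdivrMr// mul1r lerB.
  split; first by rewrite dot_uvecD !dot_uvecZ Ev Ew; ring.
  transitivity (r * v.1 + (1 - r) * w.1) => //; rewrite /r.
  by field; rewrite gt_eqF.
have xI : a1 <= x <= b1 by rewrite -qx left_end_min ?right_end_max.
split=> //; apply/eqP; rewrite eq_le; apply/andP; split.
  by have /le_roof/(_ t tn) := lexx (roof c x).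
have <- : q.2 = line (c t) t x by rewrite -qx; apply/dot_eq_line.
by rewrite -qx; have /(bodyP om thP)/andP[] := bq.
Qed.

Lemma sin_sigma t : t \in normals -> lambda (full_edge t) = (sin t * sigma (body c) t)%:E.
Proof.
move=> tn; have st := sin_normals om thP tn.
rewrite full_edgeE// /sigma.
have [[vb Ev] Hv] := vplusP t cB B0; have [fw Hw] := vminusP t cB B0.
have [wb Ew] := fw; have le := Hv _ fw.
have vw : (vplus (body c) t).1 <= (vminus (body c) t).1.
  by rewrite !(fst_frame t) Ev Ew lerD2l lerN2 ler_pM2r.
rewrite lebesgue_measure_segment// sin_euclid_dist//; last by rewrite dot_uvecB Ev Ew subrr.
by rewrite ger0_norm// subr_ge0.
Qed.

(** Two sides of the cap have at most one abscissa in common, so up to a finite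
    set their projections are disjoint. *)
Lemma sum_full_edge : (\sum_(t <- undup normals) lambda (full_edge t) <= (b1 - a1)%:E)%E.
Proof.
have ab := ends_le om thP th0 cP c1 c2.
have fX := finite_crossings c (normals_range om thP).
have mF t : t \in normals -> measurable (full_edge t).
  by move=> tn; rewrite full_edgeE//; exact: measurable_itv.
pose F t := full_edge t `\` crossings normals c.
rewrite (_ : \sum_(t <- undup normals) lambda (full_edge t) =
    \sum_(t <- undup normals) lambda (F t))%E; last first.
  rewrite big_seq [RHS]big_seq; apply: eq_bigr => t; rewrite mem_undup => tn.
  by rewrite /F lebesgue_setD_finite//; exact: mF.
rewrite fsbig_seq ?undup_uniq// -measure_fin_bigcup//; last first.
- move=> t; rewrite /= mem_undup => tn; apply: measurableD; first exact: mF.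
  exact: measurable_finite.
- move=> t u; rewrite /= !mem_undup => tn un [x [[[_ Et] X] [[_ Eu] _]]].
  apply: contrapT => /eqP tu; apply: X; exists t, u; split=> //.
  by rewrite -Et -Eu.
rewrite -(lebesgue_measure_segment ab); apply: le_measure; rewrite ?inE.
- apply: fin_bigcup_measurable => // t; rewrite /= mem_undup => tn.
  by apply: measurableD; [exact: mF|exact: measurable_finite].
- exact: measurable_itv.
- by move=> x [t _ [[xI _] _]]; rewrite /= in_itv.
Qed.

End Sigma.

(** * Polylines on a graph *)

Section Epigraph.
Context {R : realType}.
Implicit Types (f : R -> R) (p : R * R).

Lemma boundary_epigraph f : continuous f ->
  boundary [set p : R * R | f p.1 <= p.2] = [set p | p.2 = f p.1].
Proof.
move=> cf; pose h (p : R * R) := p.2 - f p.1.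
have ch : continuous h.
  move=> p; apply: cvgB; first exact: cvg_snd.
  by apply: (@continuous_comp _ _ _ fst f); [exact: cvg_fst|exact: cf].
have cE : closed [set p : R * R | f p.1 <= p.2].
  rewrite (_ : [set p | _] = h @^-1` [set y | 0 <= y]).
    by apply: closed_comp; [move=> p _; exact: ch|exact: closed_ge].
  by apply/seteqP; split=> p; rewrite /h /= subr_ge0.
rewrite /boundary -(closure_id _).1//; apply/seteqP; split=> p /=.
  case=> fp; apply: contra_notP => np.
  have oU : open [set p : R * R | f p.1 < p.2].
    rewrite (_ : [set p | _] = h @^-1` [set y | 0 < y]).
      by apply: open_comp; [move=> q _; exact: ch|exact: open_gt].
    by apply/seteqP; split=> q; rewrite /h /= subr_gt0.
  apply: (@filterS _ _ _ [set p : R * R | f p.1 < p.2]); first by move=> q /= /ltW.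
  by apply: open_nbhs_nbhs; split=> //=; rewrite lt_neqAle fp andbT eq_sym; apply/eqP.
case: p => x y /= Ep; split; first by rewrite /= Ep.
move=> Ip.
have c1 : (fun=> x) @ (0 : R) --> x by exact: cvg_cst.
have c2 : (fun d : R => y - d) @ (0 : R) --> y.
  by rewrite -[X in _ --> X]subr0; apply: cvgB; [exact: cvg_cst|exact: cvg_id].
have C : nbhs (0 : R) [set d | f x <= y - d] := cvg_pair c1 c2 Ip.
have [e /= e0 He] := (nbhs_ballP (0 : R) _).1 (C _ _ _).
have := He (e / 2); rewrite /ball /= sub0r normrN ger0_norm ?divr_ge0 ?(ltW e0)//.
by rewrite Ep; lra.
Qed.

End Epigraph.

Section Polylines.
Context {R : realType}.
Local Notation lambda := (@lebesgue_measure R).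
Implicit Types (p q : R * R) (l : seq (R * R)) (A N : set R).
Local Notation ltx := (fun p q : R * R => p.1 < q.1).

Lemma edges_cons p q l : edges [:: p, q & l] = (p, q) :: edges (q :: l).
Proof. by []. Qed.

Lemma path_last_ge q l : path ltx q l -> q.1 <= (last q l).1.
Proof.
elim: l q => [//|r l IH] q /= /andP[qr /IH]; apply: le_trans; exact: ltW.
Qed.

Lemma edges_range p l e : path ltx p l -> e \in edges (p :: l) ->
  [/\ p.1 <= e.1.1, e.1.1 < e.2.1 & e.2.1 <= (last p l).1].
Proof.
elim: l p => [//|q l IH] p /= /andP[pq pl]; rewrite edges_cons inE.
case/predU1P => [->/=|/IH[//|h1 h2 h3]]; first by rewrite lexx pq (path_last_ge pl).
by split=> //; rewrite (le_trans (ltW pq)).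
Qed.

Lemma sum_edges p l :
  \sum_(e <- edges (p :: l)) (e.2.1 - e.1.1) = (last p l).1 - p.1.
Proof.
elim: l p => [|q l IH] p; first by rewrite big_nil subrr.
by rewrite edges_cons big_cons IH /=; ring.
Qed.

(** Edges project to consecutive half-open intervals, which are disjoint; each
    one selected by P lies in A up to a finite set. *)
Lemma sum_edges_le A (P : pred ((R * R) * (R * R))) p l : measurable A -> path ltx p l ->
  (forall e, e \in edges (p :: l) -> P e ->
    exists2 N, finite_set N & `]e.1.1, e.2.1[%classic `\` N `<=` A) ->
  ((\sum_(e <- edges (p :: l) | P e) (e.2.1 - e.1.1))%:E <=
   lambda (A `&` `[p.1, (last p l).1[%classic))%E.
Proof.
move=> mA; elim: l p => [|q l IH] p; first by rewrite big_nil measure_ge0.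
move=> /andP[pq pl] H; have {}pq : p.1 < q.1 := pq.
have ql := path_last_ge pl.
have {}IH := IH q pl (fun e eE => H e (mem_behead (s := edges (p :: q :: l)) eE)).
have mI x y : measurable (A `&` `[x, y[%classic : set R).
  by apply: measurableI => //; exact: measurable_itv.
rewrite last_cons (_ : A `&` `[p.1, (last q l).1[%classic =
   (A `&` `[p.1, q.1[%classic) `|` (A `&` `[q.1, (last q l).1[%classic)); last first.
  rewrite -setIUr; congr (_ `&` _); apply/seteqP; split=> x; rewrite /= !in_itv/=.
    by case/andP => h1 h2; case: (ltP x q.1) => h3; [left|right]; rewrite ?h1 ?h2.
  case=> /andP[h1 h2]; first by rewrite h1 (lt_le_trans h2).
  by rewrite h2 (le_trans (ltW pq)).
rewrite measureU; [|exact: mI|exact: mI|]; last first.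
  apply/seteqP; split=> // x [[_] + [_]]; rewrite /= !in_itv/=.
  by move=> /andP[_ h] /andP[h' _]; move: (lt_le_trans h h'); rewrite ltxx.
rewrite edges_cons big_cons; case: ifPn => [Pe|_]; last first.
  by apply: le_trans IH _; rewrite leeDr// measure_ge0.
rewrite EFinD leeD//.
have [N fN NA] := H _ (mem_head _ _) Pe.
apply: (@le_trans _ _ (lambda (`]p.1, q.1[%classic `\` N))).
  rewrite lebesgue_setD_finite//.
  by rewrite lebesgue_measure_itv/= lte_fin pq.
apply: le_measure; rewrite ?inE.
- by apply: measurableD; [exact: measurable_itv|exact: measurable_finite].
- exact: mI.
move=> x xN; split; first exact: NA.
by case: xN; rewrite /= !in_itv/= => /andP[/ltW -> ->].
Qed.

End Polylines.

(** * Affine pieces and lists of breakpoints *)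

Section AffinePieces.
Context {R : realType}.
Implicit Types (x y z m al be : R).

Lemma affine_sign al be x y m z : x < m < y -> x <= z <= y ->
  (forall w, x < w < y -> al - w * be != 0) ->
  al - m * be <= 0 -> al - z * be <= 0.
Proof.
move=> /andP[xm my] /andP[xz zy] H hm.
have {}hm : al - m * be < 0 by rewrite lt_neqAle hm H// xm.
rewrite leNgt; apply/negP => hz.
have be0 : be != 0 by apply/eqP => b0; move: hm hz; rewrite b0; lra.
have wE : al - (al / be) * be = 0 by rewrite divfK// subrr.
have [ltbe|ltbe] : be < 0 \/ 0 < be by case: (ltgtP be 0) be0 => //; [left|right].
  have h1 : m < al / be by rewrite ltr_ndivlMr//; lra.
  have h2 : al / be < z by rewrite ltr_ndivrMr//; lra.
  have : x < al / be < y by apply/andP; split; lra.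
  by move/H; rewrite wE eqxx.
have h1 : al / be < m by rewrite ltr_pdivrMr//; lra.
have h2 : z < al / be by rewrite ltr_pdivlMr//; lra.
have : x < al / be < y by apply/andP; split; lra.
by move/H; rewrite wE eqxx.
Qed.

Lemma lineE d s x : line d s x = line d s 0 - x * (cos s / sin s) :> R.
Proof. by rewrite /line; ring. Qed.

End AffinePieces.

Section ConsecutivePairs.
Context {R : realType}.
Implicit Types (x y z : R) (l : seq R) (F : R -> R * R).

Lemma edges_map_cons F x y l :
  edges (map F [:: x, y & l]) = (F x, F y) :: edges (map F (y :: l)).
Proof. by []. Qed.

Lemma consecutive_edge F x l e : path <%R x l -> e \in edges (map F (x :: l)) ->
  exists y z, [/\ e = (F y, F z), y \in x :: l, z \in x :: l, y < z &
    forall w, w \in x :: l -> ~~ (y < w < z)].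
Proof.
elim: l x => [//|u l IH] x /andP[xu ul]; rewrite edges_map_cons inE.
have gtu w : w \in u :: l -> u <= w.
  rewrite inE => /predU1P[->//|wl].
  by move/(order_path_min lt_trans)/allP: ul => /(_ w wl)/ltW.
case/predU1P => [->|eE].
  exists x, u; split=> //; rewrite ?mem_head// ?inE ?eqxx ?orbT// => w.
  rewrite inE => /predU1P[->|/gtu uw]; first by rewrite ltxx.
  by rewrite ltNge negb_and negbK !ltNge !negbK uw orbT.
have [y [z [-> yl zl yz H]]] := IH u ul eE.
exists y, z; split=> //; [by rewrite inE yl orbT|by rewrite inE zl orbT|].
move=> w; rewrite inE => /predU1P[->|/H//].
by rewrite negb_and -!leNgt (le_trans (ltW xu)) ?gtu.
Qed.

Lemma edge_covering F x l z : path <%R x l -> x <= z <= last x l ->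
  z \in x :: l \/ exists y w, (F y, F w) \in edges (map F (x :: l)) /\ y <= z <= w.
Proof.
elim: l x => [|u l IH] x /=; first by move=> _ h; left; rewrite inE eq_le andbC.
move=> /andP[xu ul] /andP[xz zl]; have [zu|uz] := leP z u.
  by right; exists x, u; rewrite edges_map_cons mem_head xz.
have [|zul|[y [w [yw h]]]] := IH u ul; first by rewrite (ltW uz).
  by left; rewrite inE zul orbT.
by right; exists y, w; rewrite edges_map_cons inE yw orbT.
Qed.

Lemma sorted_list_between x y l : x <= y -> (forall z, z \in l -> x <= z <= y) ->
  exists m, [/\ path <%R x m, last x m = y & forall z, (z \in x :: m) = (z \in [:: x, y & l])].
Proof.
move=> xy lH; pose s := sort <=%R (undup [:: x, y & l]).
have ss : sorted <%R s by rewrite sort_lt_sorted undup_uniq.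
have sM z : (z \in s) = (z \in [:: x, y & l]) by rewrite mem_sort mem_undup.
have sxy z : z \in s -> x <= z <= y.
  by rewrite sM !inE => /or3P[/eqP->|/eqP->|/lH//]; rewrite ?lexx ?xy.
have xs : x \in s by rewrite sM mem_head.
have ys : y \in s by rewrite sM !inE eqxx orbT.
case: s ss sM sxy xs ys => [//|u m] um sM sxy xs ys.
have ux : u = x.
  move: xs; rewrite inE => /predU1P[//|xm].
  have /andP[xu _] := sxy u (mem_head _ _).
  have := order_path_min lt_trans um => /allP/(_ x xm); by rewrite ltNge xu.
subst u; exists m; split=> //.
have /andP[_ ly] := sxy _ (mem_last x m).
apply/eqP; rewrite eq_le ly /=.
move: ys um; clear; elim: m x => [|u m IH] x /=; first by rewrite inE => /eqP ->.
rewrite inE => /predU1P[->|yum] /andP[xu um]; last exact: IH.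
apply: le_trans (ltW xu) _; have := mem_last u m; rewrite inE => /predU1P[->//|h].
by apply: ltW; have /allP/(_ _ h) := order_path_min lt_trans um.
Qed.

End ConsecutivePairs.

(** * The polyline of the niche *)

Lemma eq_from_coordinates {R : realType} (p q : R * R) : p.1 = q.1 -> p.2 = q.2 -> p = q.
Proof. by case: p q => ? ? [? ?] /= -> ->. Qed.

Section NichePolyline.
Context {R : realType} (omega : R) (th : seq R).
Context (om : 0 < omega <= pi / 2) (thP : forall t, t \in th -> 0 < t < omega).
Context (th0 : th != [::]).
Local Notation Theta := [set` th].
Local Notation ground := (ground omega).
Local Notation crest := (crest omega th).
Local Notation body := (body omega th).
Local Notation hole := (hole omega th).
Local Notation normals := (normals omega th).
Local Notation cap_profile := (cap_profile omega th).
Implicit Types (v p q : R * R) (x y z s t : R).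
Context (c : R -> R) (cP : cap_profile c) (c1 : c omega = 1) (c2 : c (pi / 2) = 1).
Local Notation left_end := (left_end omega th c).
Local Notation right_end := (right_end omega th c).
Local Notation a1 := left_end.1.
Local Notation b1 := right_end.1.
Local Notation edge_core := (edge_core omega th c).

Let cB : compact (body c) := compact_body om thP th0.
Let B0 : body c !=set0 := body_nonempty cP.
Let ab : a1 <= b1 := ends_le om thP th0 cP c1 c2.

Lemma vplus_left_end : vplus (body c) (omega + pi / 2) = left_end.
Proof.
have [[vb Ev] Hv] := vplusP (omega + pi / 2) cB B0.
have ba := body_left_end om thP th0 cP c1 c2.
have va := left_end_v omega th c; have ga := left_end_ground omega th c.
have E p : dot p (vvec (omega + pi / 2)) = - dot p (uvec omega).
  by rewrite /dot /vvec /uvec /= sinDpihalf cosDpihalf; ring.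
have := Hv left_end; rewrite !E ga => /(_ _).
have [_ + _] := vb; rewrite c1 subrr => h1 h2.
have {}h2 : dot (vplus (body c) (omega + pi / 2)) (uvec omega) <= 0.
  by have := h2 (conj ba _); rewrite uvec_pihalf va => /(_ erefl); lra.
have Eu : dot (vplus (body c) (omega + pi / 2)) (uvec omega) = dot left_end (uvec omega).
  by rewrite ga; apply/eqP; rewrite eq_le h1 h2.
rewrite uvec_pihalf -va in Ev.
apply: eq_from_coordinates.
  by rewrite !(fst_frame omega) Eu Ev.
by rewrite -!dot_up !(dot_frame omega _ (pi / 2)) Eu Ev.
Qed.

Lemma vminus_right_end : vminus (body c) 0 = right_end.
Proof.
have [[wb Ew] Hw] := vminusP 0 cB B0; rewrite dot_right in Ew.
have bb := body_right_end om thP th0 cP c1 c2.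
have E p : dot p (vvec 0) = p.2.
  by rewrite /dot /vvec /= sin0 cos0; ring.
have := Hw right_end; rewrite !E => /(_ (conj bb (dot_right _))) h1.
have [_ _] := wb; rewrite c2 subrr dot_up => h2.
apply: eq_from_coordinates; first exact: Ew.
by apply/eqP; rewrite eq_le h1 h2.
Qed.

(** What remains of the fan is the epigraph of the crest. *)
Lemma fan_minus_niche : niche omega Theta (body c) = hole c ->
  boundary (fan omega `\` niche omega Theta (body c)) = [set p | p.2 = crest c p.1].
Proof.
move=> ->; rewrite -boundary_epigraph; last exact: continuous_crest.
congr boundary; apply/seteqP; split=> p.
  case=> F H; have g : ground c p.1 <= p.2.
    by apply/(cone_ground om thP); rewrite c1 c2 subrr.
  rewrite /= leNgt; apply/negP => h; apply: H; apply/(holeP om thP).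
  by rewrite g h.
move=> h; split; last by move/(holeP om thP) => /andP[_]; rewrite ltNge h.
have : ground c p.1 <= p.2 by apply: le_trans h; exact: ground_le_crest.
by move/(cone_ground om thP); rewrite c1 c2 subrr.
Qed.

(** The crest takes at each abscissa the value of some wall. Along an edge of
    normal u_t, a wall of another normal meets the line of the edge only once,
    so off a finite set the crest follows the wall of normal u_t. *)
Lemma edge_in_core t (e : (R * R) * (R * R)) : t \in normals ->
  a1 <= e.1.1 -> e.1.1 < e.2.1 -> e.2.1 <= b1 ->
  segment e.1 e.2 `<=` [set p | p.2 = crest c p.1] -> has_normal t e ->
  exists2 N, finite_set N & `]e.1.1, e.2.1[%classic `\` N `<=` edge_core t.
Proof.
case: e => p q /= tn ap pq qb pqf /eqP; rewrite /= dot_uvecB => /eqP.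
rewrite subr_eq0 => /eqP Epq.
have st := sin_normals om thP tn.
pose d s := c s - 1; pose k := dot p (uvec t).
exists (crossings normals d `|` [set` [seq (d s * sin t - k * sin s) / sin (t - s) | s <- normals]]).
  rewrite finite_setU; split; last exact: finite_seq.
  by apply: finite_crossings => s; exact: normals_range.
move=> x [/=]; rewrite in_itv /= => /andP[px xq] xN.
have xI : a1 <= x <= b1 by rewrite (le_trans ap (ltW px)) (le_trans (ltW xq)).
have qp0 : q.1 - p.1 != 0 by rewrite gt_eqF// subr_gt0.
pose r := (x - p.1) / (q.1 - p.1).
have Ex : crest c x = line k t x.
  pose w := (1 - r) *: p + r *: q.
  have w1 : w.1 = x.
    transitivity ((1 - r) * p.1 + r * q.1) => //; rewrite /r.
    by field.
  have sw : segment p q w.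
    have qp : 0 < q.1 - p.1 by rewrite subr_gt0.
    exists r => //=; rewrite in_itv /=; apply/andP; split.
      by rewrite divr_ge0 ?(ltW qp)// subr_ge0 ltW.
    by rewrite ler_pdivrMr// mul1r lerB// ltW.
  have fw : w.2 = crest c w.1 := pqf w sw.
  rewrite -w1 -fw; apply/dot_eq_line => //.
  by rewrite dot_uvecD !dot_uvecZ Epq /k; ring.
have [s sn Es] := crest_wall omega th c x.
have st' : s = t.
  apply: contrapT => /eqP nst; apply: xN; right; apply/mapP; exists s => //.
  apply: line_cross; rewrite ?(normals_range om thP)//; first by rewrite eq_sym.
  by rewrite -Ex Es.
subst s; split=> // s sn' nst; apply/eqP => E; apply: xN; left.
by exists s, t.
Qed.

(** Between two crossings the walls keep their order, hence a lattice polynomial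
    in them follows the same wall throughout. *)
Lemma affine_piece x y : x < y ->
  (forall z, x < z < y -> ~ crossings normals (fun s => c s - 1) z) ->
  exists2 s, s \in normals & forall z, x <= z <= y -> crest c z = wall c s z.
Proof.
move=> xy H; pose m := (x + y) / 2.
have xmy : x < m < y by rewrite /m; apply/andP; split; lra.
(* The wall is read off at the midpoint, where no two walls of distinct normals
   agree. *)
have [s sn Es] := crest_wall omega th c m; exists s => // z xzy.
have key u (v : R) : u \in normals -> v \in normals -> wall c u m <= wall c v m -> wall c u z <= wall c v z.
  move=> un vn; have [->//|uv] := eqVneq u v.
  rewrite -[wall c u m <= _]subr_le0 -[wall c u z <= _]subr_le0 /wall.
  rewrite !(lineE _ _ m) !(lineE _ _ z).
  have E w : line (c u - 1) u 0 - w * (cos u / sin u) - (line (c v - 1) v 0 - w * (cos v / sin v))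
    = (line (c u - 1) u 0 - line (c v - 1) v 0) - w * (cos u / sin u - cos v / sin v) by ring.
  rewrite !E; apply: affine_sign xmy xzy _ => w xwy; rewrite -E -(lineE _ u) -(lineE _ v) subr_eq0.
  by apply/eqP => Ew; apply: (H w xwy); exists u, v.
have /crest_le[] := lexx (crest c m); rewrite ground_le Es => /andP[h1 h2] h3.
have ow := omega_normal omega th; have ph := pihalf_normal omega th.
apply/eqP; rewrite eq_le; apply/andP; split.
  apply/crest_le; rewrite ground_le !key//; split=> // u uth.
  by case: (h3 u uth) => h; [left|right]; apply: key => //;
    [exact: theta_normal|exact: theta_pihalf_normal].
have /le_crest[] := lexx (crest c m); rewrite ?le_ground Es.
  case/orP => h; apply: (le_trans _ (ground_le_crest omega th c z)); rewrite le_ground.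
    by rewrite (key _ _ sn ow h).
  by rewrite (key _ _ sn ph h) orbT.
case=> u uth [g1 g2]; apply/le_crest; right; exists u => //.
by split; apply: key => //; [exact: theta_normal|exact: theta_pihalf_normal].
Qed.

(** Beyond the left end the crest is the ground, which there is the lower line
    of normal u_omega. *)
Lemma left_ray : open_ray left_end (vvec omega) =
  [set p | p.1 < a1 /\ p.2 = crest c p.1].
Proof.
have sw := sin_omega om thP; have cw := cos_omega om.
have key r : 0 < r -> (left_end + r *: vvec omega).2 = crest c (left_end + r *: vvec omega).1.
  move=> r0; set q := left_end + r *: vvec omega.
  have q1 : q.1 < a1.
    have -> : q.1 = a1 - r * sin omega.
      by transitivity (a1 + r * - sin omega) => //; rewrite mulrN.
    by rewrite gtrBl mulr_gt0.
  have -> : crest c q.1 = ground c q.1.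
    by apply: (crest_off_ends om thP th0 cP c1 c2); rewrite negb_and -!leNgt (ltW q1).
  have qw : q.2 = wall c omega q.1.
    rewrite /wall; apply/dot_eq_line => //.
    by rewrite /q dot_uvecD left_end_ground dot_uvecZ dot_vu mulr0 addr0 c1 subrr.
  rewrite groundE max_l -?qw// wall_up c2 subrr.
  have [_ _] := body_left_end om thP th0 cP c1 c2; rewrite c2 subrr dot_up => a2.
  have -> : q.2 = left_end.2 + r * cos omega by [].
  by rewrite addr_ge0// mulr_ge0// ltW.
apply/seteqP; split=> p.
  case=> r /=; rewrite in_itv /= andbT => r0 <-; split; last exact: key.
  have -> : (left_end + r *: vvec omega).1 = a1 - r * sin omega.
    by transitivity (a1 + r * - sin omega) => //; rewrite mulrN.
  by rewrite gtrBl mulr_gt0.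
case=> pa Ep; pose r := (a1 - p.1) / sin omega.
have r0 : 0 < r by rewrite divr_gt0// subr_gt0.
exists r; first by rewrite /= in_itv /= andbT.
have E1 : (left_end + r *: vvec omega).1 = p.1.
  transitivity (a1 + r * - sin omega) => //.
  by rewrite mulrN /r divfK ?gt_eqF// opprB addrC subrK.
by apply: eq_from_coordinates => //; rewrite key// E1.
Qed.

(** Beyond the right end the crest is the ground, which there is the horizontal
    axis. *)
Lemma right_ray : open_ray right_end (uvec 0) =
  [set p | b1 < p.1 /\ p.2 = crest c p.1].
Proof.
have sw := sin_omega om thP; have cw := cos_omega om.
have key x : b1 < x -> crest c x = 0.
  move=> bx.
  rewrite (crest_off_ends om thP th0 cP c1 c2); last first.
    by rewrite negb_and -!leNgt (ltW bx) orbT.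
  rewrite groundE wall_up c2 subrr max_r// /wall -(@line_le_dot _ _ _ (x, 0))//.
  rewrite c1 subrr dot_uvec mul0r addr0 /=.
  have [_ + _] := body_right_end om thP th0 cP c1 c2.
  rewrite c1 subrr dot_uvec /= mul0r addr0 => h; apply: le_trans h _.
  by rewrite ler_wpM2r// ltW.
have E r : right_end + r *: uvec 0 = (b1 + r, 0).
  apply: eq_from_coordinates.
    by transitivity (b1 + r * cos 0) => //; rewrite cos0 mulr1.
  by transitivity (0 + r * sin 0 : R) => //; rewrite sin0 mulr0 addr0.
apply/seteqP; split=> p.
  case=> r /=; rewrite in_itv /= andbT => r0 <-; rewrite E /= ltrDl; split=> //.
  by rewrite key// ltrDl.
case=> bp Ep; exists (p.1 - b1); first by rewrite /= in_itv /= andbT subr_gt0.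
rewrite E; apply: eq_from_coordinates; first by rewrite /= addrC subrK.
by rewrite Ep key.
Qed.

(** The vertices are the two ends and all points of the crest above crossings of
    walls in between. *)
Lemma niche_polyline_exists : niche omega Theta (body c) = hole c ->
  exists l, is_niche_polyline omega Theta (body c) l.
Proof.
move=> nE; pose F x := (x, crest c x).
have [cr crE] : exists cr : seq R, crossings normals (fun s => c s - 1) = [set` cr].
  by apply/finite_seqP/finite_crossings => s; exact: normals_range.
(* a1 :: m are the abscissas of the vertices. *)
have [|m [am mb mE]] := sorted_list_between ab (l := [seq x <- cr | a1 <= x <= b1]).
  by move=> z; rewrite mem_filter => /andP[].
have mI z : z \in a1 :: m -> a1 <= z <= b1.
  rewrite mE !inE mem_filter => /or3P[/eqP->|/eqP->|/andP[]//]; by rewrite lexx ab.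
have piece (e : (R * R) * (R * R)) : e \in edges (map F (a1 :: m)) -> exists x y,
    [/\ e = (F x, F y), a1 <= x, x < y, y <= b1 &
    exists2 s, s \in normals & forall z, x <= z <= y -> crest c z = wall c s z].
  case/(consecutive_edge am) => x [y [-> xl yl xy H]].
  have /andP[ax _] := mI x xl; have /andP[_ yb] := mI y yl.
  exists x, y; split=> //; apply: affine_piece => // z xzy zcr.
  have zI : a1 <= z <= b1 by case/andP: xzy => h1 h2; rewrite (le_trans ax (ltW h1)) (le_trans (ltW h2)).
  have : z \in a1 :: m.
    by rewrite mE !inE mem_filter zI; move: zcr; rewrite crE /= => ->; rewrite !orbT.
  by move/H; rewrite xzy.
have graph : polyline_set (map F (a1 :: m)) = [set p | a1 <= p.1 <= b1 /\ p.2 = crest c p.1].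
  apply/seteqP; split=> p.
    case=> [/mapP[x xl ->]|[e /piece[x [y [-> ax xy yb [s sn H]]]]]]; first by split=> //; exact: mI.
    case=> r /=; rewrite in_itv /= => /andP[r0 r1] <-.
    pose w : R * R := (1 - r) *: F x + r *: F y; rewrite -/w.
    have w1 : w.1 = (1 - r) * x + r * y by [].
    have w2 : w.2 = (1 - r) * crest c x + r * crest c y by [].
    have wI : x <= w.1 <= y by rewrite w1; apply/andP; split; nra.
    split; first by case/andP: wI => h1 h2; rewrite (le_trans ax h1) (le_trans h2).
    rewrite (H _ wI) w2 w1 !H ?lexx ?ltW//.
    by rewrite /wall (lineE _ _ x) (lineE _ _ y) [RHS]lineE; ring.
  case=> pI Ep; have pE : p = F p.1 by exact: eq_from_coordinates.
  have [|pl|[x [y [xye xpy]]]] := edge_covering F (z := p.1) am; first by rewrite mb.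
    by left; rewrite pE; exact: map_f.
  right; exists (F x, F y) => //.
  have [x' [y' [[ex _ ey _] ax xy yb [s sn H]]]] := piece _ xye.
  subst x' y'; have yx : 0 < y - x by rewrite subr_gt0.
  have rx : (1 - (p.1 - x) / (y - x)) * x + (p.1 - x) / (y - x) * y = p.1.
    by field; rewrite gt_eqF.
  exists ((p.1 - x) / (y - x)).
    case/andP: xpy => h1 h2; rewrite /= in_itv /=; apply/andP; split.
      by rewrite divr_ge0 ?(ltW yx)// subr_ge0.
    by rewrite ler_pdivrMr// mul1r lerB.
  apply: eq_from_coordinates; first exact: rx.
  set r := _ / _ in rx *.
  transitivity ((1 - r) * crest c x + r * crest c y) => //.
  rewrite Ep (H p.1 xpy) !H ?lexx ?ltW// -rx.
  by rewrite /wall (lineE _ _ x) (lineE _ _ y) [RHS]lineE; ring.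
have Fa : F a1 = left_end.
  apply: eq_from_coordinates => //=.
  have sw := sin_omega om thP.
  rewrite (crest_off_ends om thP th0 cP c1 c2) ?ltxx//.
  have E : left_end.2 = wall c omega a1.
    by rewrite /wall; apply/dot_eq_line => //; rewrite left_end_ground c1 subrr.
  rewrite groundE max_l -?E//.
  by have [_ _] := body_left_end om thP th0 cP c1 c2; rewrite dot_up wall_up.
have Fb : F b1 = right_end.
  apply: eq_from_coordinates => //=.
  rewrite (crest_off_ends om thP th0 cP c1 c2) ?ltxx ?andbF//.
  have sw := sin_omega om thP.
  rewrite groundE wall_up c2 subrr max_r// /wall -(@line_le_dot _ _ _ right_end)//.
  by have [_ + _] := body_right_end om thP th0 cP c1 c2.
exists (map F (a1 :: m)); rewrite /is_niche_polyline vplus_left_end vminus_right_end.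
rewrite left_ray right_ray fan_minus_niche// graph; split.
- by rewrite /= last_map mb Fa Fb.
- by rewrite sorted_map.
- move=> e /piece[x [y [-> ax xy yb [s sn H]]]]; exists s; first exact/diamondE.
  rewrite /has_normal dot_uvecB subr_eq0; apply/eqP.
  have st := sin_normals om thP sn.
  transitivity (c s - 1); first by apply/dot_eq_line => //=; apply: H; rewrite lexx ltW.
  by apply/esym/dot_eq_line => //=; apply: H; rewrite lexx ltW.
- apply/seteqP; split=> p /=; last by case=> [[[_ ->]|[_ ->]]|[_ ->]].
  move=> Ep; case: (ltP p.1 a1) => h1; first by left; left.
  by case: (ltP b1 p.1) => h2; [left; right|right].
- split; apply/seteqP; split=> // p /= [[h1 _] [h2 _]].
  + by move: (lt_trans h1 (le_lt_trans ab h2)); rewrite ltxx.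
  + by case/andP: h2 => h2 _; move: (lt_le_trans h1 h2); rewrite ltxx.
  + by case/andP: h2 => _ h2; move: (lt_le_trans h1 h2); rewrite ltxx.
Qed.

End NichePolyline.

(** * Balance *)

Section Balance.
Context {R : realType} (omega : R) (th : seq R).
Context (om : 0 < omega <= pi / 2) (thP : forall t, t \in th -> 0 < t < omega).
Context (th0 : th != [::]).
Local Notation lambda := (@lebesgue_measure R).
Local Notation Theta := [set` th].
Local Notation body := (body omega th).
Local Notation hole := (hole omega th).
Local Notation normals := (normals omega th).
Local Notation cap_profile := (cap_profile omega th).
Context (c : R -> R) (cP : cap_profile c) (c1 : c omega = 1) (c2 : c (pi / 2) = 1).
Local Notation a1 := (left_end omega th c).1.
Local Notation b1 := (right_end omega th c).1.
Local Notation edge_core := (edge_core omega th c).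

Context (s : seq (R * R)) (nE : niche omega Theta (body c) = hole c).
Context (sP : is_niche_polyline omega Theta (body c) s).

Lemma polyline_path : exists m,
  [/\ s = left_end omega th c :: m, path (fun p q : R * R => p.1 < q.1) (left_end omega th c) m
    & last (left_end omega th c) m = right_end omega th c].
Proof.
case: sP; rewrite vplus_left_end// vminus_right_end//.
case: s => [|p m] [[]//= [->]] lE ps _ _ _; by exists m.
Qed.

(** An upper bound by the measure of [edge_core] suffices, since equality is
    forced at the end by comparing total widths; it holds for every admissible
    list of vertices, whichever one is chosen. *)
Lemma polyline_width t : t \in normals ->
  ((\sum_(e <- edges s | has_normal t e) (e.2.1 - e.1.1))%:E <= lambda (edge_core t))%E.
Proof.
move=> tn; have [m [sE pm lm]] := polyline_path.
have mD : measurable (edge_core t).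
  rewrite -(edge_core_bigcup omega th c t (e := fun n => n.+1%:R^-1)).
  - by apply: bigcup_measurable => n _; exact: measurable_core_edge.
  - by move=> n; rewrite invr_gt0.
  - by move=> d /ltr_add_invr[n]; rewrite add0r; exists n.
have graph e : e \in edges s -> segment e.1 e.2 `<=` [set p | p.2 = crest omega th c p.1].
  move=> es p pe; rewrite -(fan_minus_niche om thP c1 c2 nE).
  by case: sP => _ _ _ -> _; right; right; exists e.
rewrite sE in graph *.
apply: le_trans (sum_edges_le (P := has_normal t) mD pm _) _.
  move=> e es et; have [h1 h2 h3] := edges_range pm es.
  by apply: (edge_in_core om thP tn) => //; [rewrite lm in h3|exact: graph].
apply: le_measure; rewrite ?inE//.
by apply: measurableI => //; exact: measurable_itv.
Qed.

(** Each edge has a normal in the diamond, so it is counted at least once;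
    widths of edges telescope. *)
Lemma polyline_total_width :
  b1 - a1 <= \sum_(t <- undup normals) \sum_(e <- edges s | has_normal t e) (e.2.1 - e.1.1).
Proof.
have [m [sE pm lm]] := polyline_path.
have -> : b1 - a1 = \sum_(e <- edges s) (e.2.1 - e.1.1) by rewrite sE sum_edges lm.
rewrite (exchange_big_dep predT)//= big_seq [leRHS]big_seq.
apply: ler_sum => e es; case: sP => _ _ /(_ e es)[t /diamondE tn et] _ _.
have e0 : 0 <= e.2.1 - e.1.1.
  by rewrite subr_ge0 ltW//; rewrite sE in es; have [] := edges_range pm es.
rewrite big_mkcond /= (bigD1_seq t) ?mem_undup ?undup_uniq//= et lerDl.
by apply: sumr_ge0 => u _; case: ifP.
Qed.

End Balance.

Lemma angle_set_seq {R : realType} (omega : R) (Theta : set R) : angle_set omega Theta ->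
  exists th : seq R, [/\ Theta = [set` th], th != [::] & forall t, t \in th -> 0 < t < omega].
Proof.
case=> /finite_seqP[th ->] [t tth] sub; exists th; split=> //.
by apply/eqP => th0; rewrite th0 in tth.
Qed.

Theorem theorem3p4p9 (R : realType) (omega : R) (Theta : set R) (K : set (R * R)) :
  0 < omega <= pi / 2 ->
  angle_set omega Theta ->
  maximum_polygon_cap omega Theta K ->
  balanced omega Theta K.
Proof.
move=> om /angle_set_seq[th [-> th0 thP]] Kmax t /diamondE tn.
have Kcap : polygon_cap omega [set` th] K by case: Kmax.
have [KE cP c1 c2] := cap_polygon Kcap.
have nE : niche omega [set` th] K = hole omega th (supp K) by exact: hole_niche.
have cmax d := @maximum_cap_le _ _ _ om thP K d th0 Kmax.
move: (supp K) KE cP c1 c2 nE cmax => c KE cP c1 c2.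
rewrite {}KE => nE cmax.
pose s := niche_polyline omega [set` th] (body omega th c).
have sP : is_niche_polyline omega [set` th] (body omega th c) s.
  have [r rP] := niche_polyline_exists om thP th0 cP c1 c2 nE.
  by apply: xgetPex; exists r.
pose T u := \sum_(e <- edges s | has_normal u e) (e.2.1 - e.1.1).
have Ttau u : u \in normals omega th -> sin u * tau omega [set` th] (body omega th c) u = T u.
  move=> un; have su := sin_normals om thP un.
  rewrite /tau /T mulr_sumr big_seq_cond [RHS]big_seq_cond.
  apply: eq_bigr => e /andP[es /eqP eu].
  rewrite sin_euclid_dist// ger0_norm// subr_ge0.
  have [m [sE pm _]] := polyline_path om thP th0 cP c1 c2 sP.
  by rewrite -/s sE in es; have [_ /ltW] := edges_range pm es.
have Tle u : u \in normals omega th -> T u <= sin u * sigma (body omega th c) u.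
  move=> un; rewrite -lee_fin -(sin_sigma om thP th0 cP c1 c2 un).
  apply: le_trans (polyline_width om thP th0 cP c1 c2 nE sP un) _.
  apply: core_le_full_edge => // d dP d1 d2 dfin.
  apply: cmax => //; exact: area_hole_lt (crest_off_ends om thP th0 cP c1 c2).
have Tsum : \sum_(u <- undup (normals omega th)) (sin u * sigma (body omega th c) u) <=
    \sum_(u <- undup (normals omega th)) T u.
  apply: le_trans _ (polyline_total_width om thP th0 cP c1 c2 sP).
  rewrite -lee_fin -sumEFin; apply: le_trans _ (sum_full_edge om thP th0 cP c1 c2).
  rewrite big_seq [leRHS]big_seq; apply: lee_sum => u; rewrite mem_undup => un.
  by rewrite (sin_sigma om thP th0 cP c1 c2 un).
have TE : T t = sin t * sigma (body omega th c) t.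
  apply/eqP; rewrite eq_le Tle//= -subr_le0.
  apply: le_trans (_ : \sum_(u <- undup (normals omega th))
    (sin u * sigma (body omega th c) u - T u) <= 0); last by rewrite sumrB subr_le0.
  rewrite (bigD1_seq t) ?mem_undup ?undup_uniq//= lerDl big_seq_cond.
  by apply: sumr_ge0 => u /andP[]; rewrite mem_undup => un _; rewrite subr_ge0 Tle.
have st := sin_normals om thP tn.
by apply: (mulfI (lt0r_neq0 st)); rewrite -TE Ttau.
Qed.
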